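(* Let $n\geqslant 1$, let $R\subset S$ be an embedding of rings, $Y$ be an ind-flat ind-affine scheme over $R$, $Z$ be an affine scheme over $R$, and $N$ be a natural number. Then the natural map $$\mathrm{Hom}_R\big((L^n\mathbb G_m)_R^{\times N}\times Y,\,Z\big)\longrightarrow\mathrm{Hom}_S\big((L^n\mathbb G_m)_S^{\times N}\times Y_S,\,Z_S\big)$$ is injective.
   Context: All rings are commutative, associative and unital. A functor over a ring $R$ is a covariant functor from $R$-algebras to sets; $F_R$ is the restriction to $R$-algebras of a functor $F$ on rings; $\mathrm{Hom}_R$ denotes the set of natural transformations of functors over $R$ (not required to respect any group structure). The natural map is restriction from $R$-algebras to $S$-algebras, with $Y_S$, $Z_S$ the base changes. $L^n\mathbb G_m$ is the functor $A\mapsto\big(A((t_1))\ldots((t_n))\big)^*$, where $A((t))=A[[t]][t^{-1}]$, and $F^{\times N}$ is the $N$-fold Cartesian power of a functor $F$. An ind-affine scheme over $R$ is an ind-object ''$\varinjlim_{j\in J}$''$Y_j$ ($J$ a directed partially ordered set) in the category of affine schemes over $R$; it is identified with the functor $A\mapsto\varinjlim_jY_j(A)$ on $R$-algebras. It is ind-flat over $R$ if it is isomorphic to some ''$\varinjlim_{j\in J}$''$Y_j$ with every $Y_j$ a flat affine scheme over $R$. *)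

(* Defs.v *)
From HB Require Import structures.
From mathcomp Require Import all_boot all_order all_algebra generic_quotient.
From mathcomp Require Import boolp classical_sets functions fsbigop.
From mathcomp Require Import zify.

Set Implicit Arguments.
Unset Strict Implicit.
Unset Printing Implicit Defensive.

Import Order.TTheory GRing.Theory Num.Theory.
Local Open Scope ring_scope.
Local Open Scope quotient_scope.

(* Rings are [comPzRingType]s, so the zero ring is included.  The algebra     *)
(* structures of the library exclude it; an R-algebra is therefore encoded    *)
(* as a ring with a structure morphism.                                       *)

Lemma rmorph_ext (A B : pzSemiRingType) (f g : {rmorphism A -> B}) :
  f =1 g -> f = g.
Proof.
case: f g => [f [[f1] [f2]]] [g [[g1] [g2]]] /= /funext fg.
case: g / fg in g1 g2 *.
by rewrite (Prop_irrelevance f1 g1) (Prop_irrelevance f2 g2).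
Qed.

Record algebra (R : comPzRingType) := Algebra {
  alg_ring :> comPzRingType;
  alg_map : {rmorphism R -> alg_ring}
}.

Record alg_hom (R : comPzRingType) (A B : algebra R) := AlgHom {
  alg_fun :> {rmorphism A -> B};
  alg_funE : forall r, alg_fun (alg_map A r) = alg_map B r
}.

Section AlgHom.
Variable R : comPzRingType.

Lemma alg_hom_ext (A B : algebra R) (f g : alg_hom A B) : f =1 g -> f = g.
Proof.
case: f g => [f fE] [g gE] /= /rmorph_ext fg.
by case: g / fg in gE *; rewrite (Prop_irrelevance fE gE).
Qed.

Definition alg_id (A : algebra R) : alg_hom A A :=
  @AlgHom R A A (idfun : {rmorphism A -> A}) (fun=> erefl).

Lemma alg_compE (A B C : algebra R) (g : alg_hom B C) (f : alg_hom A B) r :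
  (g \o f : {rmorphism A -> C}) (alg_map A r) = alg_map C r.
Proof. by rewrite /= !alg_funE. Qed.

Definition alg_comp (A B C : algebra R) (g : alg_hom B C) (f : alg_hom A B) :
  alg_hom A C := AlgHom (alg_compE g f).

Lemma alg_compA (A B C D : algebra R) (h : alg_hom C D) (g : alg_hom B C)
    (f : alg_hom A B) : alg_comp h (alg_comp g f) = alg_comp (alg_comp h g) f.
Proof. exact: alg_hom_ext. Qed.

End AlgHom.

Definition restrict_scalars (R S : comPzRingType) (phi : {rmorphism R -> S})
    (A : algebra S) : algebra R :=
  @Algebra R A (alg_map A \o phi : {rmorphism R -> A}).

Lemma restrict_scalars_homE (R S : comPzRingType) (phi : {rmorphism R -> S})
    (A B : algebra S) (f : alg_hom A B) r :
  (alg_fun f) (alg_map (restrict_scalars phi A) r) =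
  alg_map (restrict_scalars phi B) r.
Proof. exact: alg_funE. Qed.

Definition restrict_scalars_hom (R S : comPzRingType)
    (phi : {rmorphism R -> S}) (A B : algebra S) (f : alg_hom A B) :
    alg_hom (restrict_scalars phi A) (restrict_scalars phi B) :=
  @AlgHom R (restrict_scalars phi A) (restrict_scalars phi B) (alg_fun f)
    (restrict_scalars_homE phi f).

Record ring_functor := RingFunctor {
  ring_obj :> comPzRingType -> Type;
  ring_fmap : forall A B : comPzRingType,
    {rmorphism A -> B} -> ring_obj A -> ring_obj B;
  ring_fmap_id : forall (A : comPzRingType) (x : ring_obj A),
    ring_fmap (idfun : {rmorphism A -> A}) x = x;
  ring_fmap_comp : forall (A B C : comPzRingType)
      (g : {rmorphism B -> C}) (f : {rmorphism A -> B}) (x : ring_obj A),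
    ring_fmap (g \o f : {rmorphism A -> C}) x = ring_fmap g (ring_fmap f x)
}.

Record functor_over (R : comPzRingType) := FunctorOver {
  fobj :> algebra R -> Type;
  fmap : forall A B : algebra R, alg_hom A B -> fobj A -> fobj B;
  fmap_id : forall (A : algebra R) (x : fobj A), fmap (alg_id A) x = x;
  fmap_comp : forall (A B C : algebra R)
      (g : alg_hom B C) (f : alg_hom A B) (x : fobj A),
    fmap (alg_comp g f) x = fmap g (fmap f x)
}.

Definition natural (R : comPzRingType) (F G : functor_over R)
    (eta : forall A : algebra R, F A -> G A) : Prop :=
  forall (A B : algebra R) (f : alg_hom A B) (x : F A),
    eta B (fmap f x) = fmap f (eta A x).

(* Hom_R(F, G).  A [sig] rather than a record indexed by F and G, so that     *)
(* functors differing only in the proofs of their laws have convertible       *)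
(* transformations.                                                           *)
Definition nat_trans (R : comPzRingType) (F G : functor_over R) : Type :=
  {eta : forall A : algebra R, F A -> G A | natural eta}.

Definition functor_iso (R : comPzRingType) (F G : functor_over R) : Prop :=
  exists (eta : nat_trans F G) (theta : nat_trans G F),
    (forall A, cancel (sval eta A) (sval theta A)) /\
    (forall A, cancel (sval theta A) (sval eta A)).

(* F_R for a functor F on rings *)
Definition restrict_functor (R : comPzRingType) (F : ring_functor) :
    functor_over R :=
  @FunctorOver R (fun A => F A) (fun A B f => ring_fmap (alg_fun f))
    (fun A => @ring_fmap_id F A)
    (fun A B C g f => ring_fmap_comp (alg_fun g) (alg_fun f)).

Section BaseChange.
Variables (R S : comPzRingType) (phi : {rmorphism R -> S}).

Lemma base_change_id (F : functor_over R) (A : algebra S)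
    (x : F (restrict_scalars phi A)) :
  fmap (restrict_scalars_hom phi (alg_id A)) x = x.
Proof. by rewrite -[RHS]fmap_id; congr fmap; apply: alg_hom_ext. Qed.

Lemma base_change_comp (F : functor_over R) (A B C : algebra S)
    (g : alg_hom B C) (f : alg_hom A B) (x : F (restrict_scalars phi A)) :
  fmap (restrict_scalars_hom phi (alg_comp g f)) x =
  fmap (restrict_scalars_hom phi g) (fmap (restrict_scalars_hom phi f) x).
Proof. by rewrite -fmap_comp; congr fmap; apply: alg_hom_ext. Qed.

(* F_S for a functor F over R.  For F = Spec C this is the functor of points  *)
(* of Spec of the S-algebra obtained from C by extension of scalars.          *)
Definition base_change (F : functor_over R) : functor_over S :=
  @FunctorOver S (fun A => F (restrict_scalars phi A))
    (fun A B f => fmap (restrict_scalars_hom phi f))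
    (@base_change_id F) (@base_change_comp F).

Lemma base_change_natural (F G : functor_over R) (eta : nat_trans F G) :
  @natural S (base_change F) (base_change G)
    (fun A => sval eta (restrict_scalars phi A)).
Proof. by move=> A B f x; apply: (svalP eta). Qed.

Definition base_change_nat (F G : functor_over R) (eta : nat_trans F G) :
    nat_trans (base_change F) (base_change G) :=
  exist _ _ (base_change_natural eta).

End BaseChange.

Arguments base_change_nat {R S} phi {F G} eta.

Section Products.
Variable R : comPzRingType.

Lemma prod_functor_id (F G : functor_over R) (A : algebra R) (x : F A * G A) :
  (fmap (alg_id A) x.1, fmap (alg_id A) x.2) = x.
Proof. by case: x => x y; rewrite !fmap_id. Qed.

Lemma prod_functor_comp (F G : functor_over R) (A B C : algebra R)
    (g : alg_hom B C) (f : alg_hom A B) (x : F A * G A) :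
  (fmap (alg_comp g f) x.1, fmap (alg_comp g f) x.2) =
  (fmap g (fmap f x.1), fmap g (fmap f x.2)).
Proof. by rewrite !fmap_comp. Qed.

Definition prod_functor (F G : functor_over R) : functor_over R :=
  @FunctorOver R (fun A => (F A * G A)%type)
    (fun A B f x => (fmap f x.1, fmap f x.2))
    (@prod_functor_id F G) (@prod_functor_comp F G).

Lemma power_functor_id (F : functor_over R) (N : nat) (A : algebra R)
    (x : 'I_N -> F A) : (fun i => fmap (alg_id A) (x i)) = x.
Proof. by apply/funext => i; rewrite fmap_id. Qed.

Lemma power_functor_comp (F : functor_over R) (N : nat) (A B C : algebra R)
    (g : alg_hom B C) (f : alg_hom A B) (x : 'I_N -> F A) :
  (fun i => fmap (alg_comp g f) (x i)) = (fun i => fmap g (fmap f (x i))).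
Proof. by apply/funext => i; rewrite fmap_comp. Qed.

Definition power_functor (F : functor_over R) (N : nat) : functor_over R :=
  @FunctorOver R (fun A => 'I_N -> F A) (fun A B f x i => fmap f (x i))
    (@power_functor_id F N) (@power_functor_comp F N).

End Products.

(* The affine scheme Spec C over R, as a functor of points. *)
Section Spec.
Variables (R : comPzRingType) (C : algebra R).

Lemma Spec_id (A : algebra R) (x : alg_hom C A) : alg_comp (alg_id A) x = x.
Proof. exact: alg_hom_ext. Qed.

Lemma Spec_comp (A B D : algebra R) (g : alg_hom B D) (f : alg_hom A B)
    (x : alg_hom C A) : alg_comp (alg_comp g f) x = alg_comp g (alg_comp f x).
Proof. exact: alg_hom_ext. Qed.

Definition Spec : functor_over R :=
  @FunctorOver R (alg_hom C) (fun A B f => alg_comp f) Spec_id Spec_comp.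

End Spec.

(* The ind-object "lim" Y_j, with Y_j = Spec (ind_alg j); a morphism          *)
(* Y_j -> Y_k is given by a homomorphism ind_alg k -> ind_alg j.              *)
Record ind_affine (R : comPzRingType) := IndAffine {
  ind_disp : Order.disp_t;
  ind_index : porderType ind_disp;
  ind_inhabited : inhabited ind_index;
  ind_directed : forall j k : ind_index,
    exists l : ind_index, (j <= l)%O /\ (k <= l)%O;
  ind_alg : ind_index -> algebra R;
  ind_trans : forall j k : ind_index,
    (j <= k)%O -> alg_hom (ind_alg k) (ind_alg j);
  ind_trans_id : forall (j : ind_index) (le_jj : (j <= j)%O),
    ind_trans le_jj = alg_id (ind_alg j);
  ind_trans_comp : forall (j k l : ind_index)
      (le_jk : (j <= k)%O) (le_kl : (k <= l)%O) (le_jl : (j <= l)%O),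
    ind_trans le_jl = alg_comp (ind_trans le_jk) (ind_trans le_kl)
}.

Section Colimit.
Variables (R : comPzRingType) (Y : ind_affine R).

Definition colim_pre (A : algebra R) : Type :=
  {classic {j : ind_index Y & Spec (ind_alg j) A}}.

Definition colim_eq (A : algebra R) (x y : colim_pre A) : Prop :=
  exists (l : ind_index Y) (le1 : (tag x <= l)%O) (le2 : (tag y <= l)%O),
    alg_comp (tagged x) (ind_trans le1) = alg_comp (tagged y) (ind_trans le2).

Definition colim_rel (A : algebra R) : rel (colim_pre A) :=
  fun x y => `[< colim_eq x y >].

Lemma colim_rel_refl A : reflexive (@colim_rel A).
Proof. by move=> x; apply/asboolP; exists (tag x), (lexx _), (lexx _). Qed.

Lemma colim_rel_sym A : symmetric (@colim_rel A).
Proof.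
move=> x y.
by apply/asboolP/asboolP => -[l [le1 [le2 e]]]; exists l, le2, le1.
Qed.

Lemma colim_rel_trans A : transitive (@colim_rel A).
Proof.
move=> y x z /asboolP[l [xl [yl e]]] /asboolP[k [yk [zk e']]].
have [m [lm km]] := ind_directed l k.
apply/asboolP; exists m, (le_trans xl lm), (le_trans zk km).
rewrite (ind_trans_comp xl lm) (ind_trans_comp zk km).
rewrite !alg_compA e -e' -!alg_compA; congr alg_comp.
by rewrite -(ind_trans_comp yl lm (le_trans yl lm)) (ind_trans_comp yk km).
Qed.

Canonical colim_equiv A : equiv_rel (colim_pre A) :=
  EquivRel (@colim_rel A) (@colim_rel_refl A) (@colim_rel_sym A)
    (@colim_rel_trans A).

Definition colim_obj (A : algebra R) : Type := {eq_quot (colim_equiv A)}.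

Definition colim_in (A : algebra R) (j : ind_index Y)
    (x : Spec (ind_alg j) A) : colim_obj A :=
  \pi_({eq_quot (colim_equiv A)})
    (Tagged (fun j => Spec (ind_alg j) A : Type) x : colim_pre A).

Lemma colim_inP A (j k : ind_index Y) (x : Spec (ind_alg j) A)
    (y : Spec (ind_alg k) A) :
  colim_in x = colim_in y <->
  exists (l : ind_index Y) (le1 : (j <= l)%O) (le2 : (k <= l)%O),
    alg_comp x (ind_trans le1) = alg_comp y (ind_trans le2).
Proof. by split=> [/eqmodP/asboolP//|H]; apply/eqmodP/asboolP. Qed.

Lemma colim_in_repr A (x : colim_obj A) : colim_in (tagged (repr x)) = x.
Proof. by apply: etrans (reprK x); rewrite /colim_in; case: (repr x). Qed.

Definition colim_map (A B : algebra R) (f : alg_hom A B) (x : colim_obj A) :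
    colim_obj B := colim_in (fmap f (tagged (repr x))).

Lemma colim_map_in A B (f : alg_hom A B) (j : ind_index Y)
    (x : Spec (ind_alg j) A) : colim_map f (colim_in x) = colim_in (fmap f x).
Proof.
have /colim_inP[l [le1 [le2 e]]] := colim_in_repr (colim_in x).
apply/colim_inP; exists l, le1, le2; apply: alg_hom_ext => b /=.
by congr (f _); have /(congr1 (fun h : alg_hom _ _ => h b)) := e.
Qed.

Lemma colim_map_id A (x : colim_obj A) : colim_map (alg_id A) x = x.
Proof. by rewrite /colim_map fmap_id colim_in_repr. Qed.

Lemma colim_map_comp A B C (g : alg_hom B C) (f : alg_hom A B)
    (x : colim_obj A) :
  colim_map (alg_comp g f) x = colim_map g (colim_map f x).
Proof. by rewrite [colim_map f x]/colim_map colim_map_in -fmap_comp. Qed.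

Definition ind_functor : functor_over R :=
  @FunctorOver R colim_obj colim_map colim_map_id colim_map_comp.

End Colimit.

(* The tensor product of two modules: the free commutative monoid on M * N    *)
(* (finite formal sums, written as sequences up to permutation) modulo the    *)
(* bilinearity relations.  It is a group, [:: (- m, n)] being opposite to     *)
(* [:: (m, n)].                                                               *)
Section Tensor.
Variables (R : comPzRingType) (M N : lmodType R).

Inductive tensor_eq : seq (M * N) -> seq (M * N) -> Prop :=
| tensor_eq_perm s t : perm_eq s t -> tensor_eq s t
| tensor_eq_sym s t : tensor_eq s t -> tensor_eq t s
| tensor_eq_trans s t u : tensor_eq s t -> tensor_eq t u -> tensor_eq s u
| tensor_eq_cat u s t : tensor_eq s t -> tensor_eq (u ++ s) (u ++ t)
| tensor_eq_addl m m' n : tensor_eq [:: (m + m', n)] [:: (m, n); (m', n)]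
| tensor_eq_addr m n n' : tensor_eq [:: (m, n + n')] [:: (m, n); (m, n')]
| tensor_eq_scale r m n : tensor_eq [:: (r *: m, n)] [:: (m, r *: n)]
| tensor_eq_zero n : tensor_eq [:: (0, n)] [::].

Definition tensor_rel : rel (seq (M * N)) := fun s t => `[< tensor_eq s t >].

Lemma tensor_rel_refl : reflexive tensor_rel.
Proof. by move=> s; apply/asboolP/tensor_eq_perm. Qed.

Lemma tensor_rel_sym : symmetric tensor_rel.
Proof. by move=> s t; apply/asboolP/asboolP => /tensor_eq_sym. Qed.

Lemma tensor_rel_trans : transitive tensor_rel.
Proof.
move=> t s u /asboolP st /asboolP tu.
by apply/asboolP; apply: tensor_eq_trans st tu.
Qed.

Canonical tensor_equiv : equiv_rel (seq (M * N)) :=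
  EquivRel tensor_rel tensor_rel_refl tensor_rel_sym tensor_rel_trans.

Definition tensor : Type := {eq_quot tensor_equiv}.

Definition tensor_sum (s : seq (M * N)) : tensor :=
  \pi_({eq_quot tensor_equiv}) s.

Lemma tensor_sumP s t : tensor_sum s = tensor_sum t <-> tensor_eq s t.
Proof. by split=> [/eqmodP/asboolP//|H]; apply/eqmodP/asboolP. Qed.

Lemma tensor_sum_repr (x : tensor) : tensor_sum (repr x) = x.
Proof. exact: reprK. Qed.

End Tensor.

(* f (x) id_N *)
Definition tensor_map (R : comPzRingType) (M M' N : lmodType R)
    (f : {linear M -> M'}) (x : tensor M N) : tensor M' N :=
  tensor_sum [seq (f p.1, p.2) | p <- repr x].

Lemma tensor_map_sum (R : comPzRingType) (M M' N : lmodType R)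
    (f : {linear M -> M'}) (s : seq (M * N)) :
  tensor_map f (tensor_sum s) = tensor_sum [seq (f p.1, p.2) | p <- s].
Proof.
apply/tensor_sumP; have /tensor_sumP := tensor_sum_repr (tensor_sum s).
move: (repr _) => s'; elim=> {s s'} /=.
- by move=> s t st; apply/tensor_eq_perm/perm_map.
- by move=> s t _; apply: tensor_eq_sym.
- by move=> s t u _ st _ tu; apply: tensor_eq_trans st tu.
- by move=> u s t _ st; rewrite !map_cat; apply: tensor_eq_cat.
- by move=> m m' n; rewrite linearD; apply: tensor_eq_addl.
- by move=> m n n'; apply: tensor_eq_addr.
- by move=> r m n; rewrite linearZ; apply: tensor_eq_scale.
- by move=> n; rewrite linear0; apply: tensor_eq_zero.
Qed.

Definition flat (R : comPzRingType) (N : lmodType R) : Prop :=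
  forall (M M' : lmodType R) (f : {linear M -> M'}),
    injective f -> injective (@tensor_map R M M' N f).

Definition alg_module (R : comPzRingType) (A : algebra R) : Type := A.

Section AlgModule.
Variables (R : comPzRingType) (A : algebra R).

HB.instance Definition _ := GRing.Zmodule.on (alg_module A).

Definition alg_scale (r : R) (a : alg_module A) : alg_module A :=
  alg_map A r * (a : A).

Lemma alg_scaleA r s a : alg_scale r (alg_scale s a) = alg_scale (r * s) a.
Proof. by rewrite /alg_scale rmorphM mulrA. Qed.

Lemma alg_scale1 : left_id 1 alg_scale.
Proof. by move=> a; rewrite /alg_scale rmorph1 mul1r. Qed.

Lemma alg_scaleDr : right_distributive alg_scale +%R.
Proof. by move=> r a b; apply: mulrDr. Qed.

Lemma alg_scaleDl a : {morph alg_scale^~ a : r s / r + s}.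
Proof. by move=> r s; rewrite /alg_scale rmorphD mulrDl. Qed.

HB.instance Definition _ := GRing.Zmodule_isLmodule.Build R (alg_module A)
  alg_scaleA alg_scale1 alg_scaleDr alg_scaleDl.

End AlgModule.

Definition flat_algebra (R : comPzRingType) (A : algebra R) : Prop :=
  flat (alg_module A : lmodType R).

Definition ind_flat (R : comPzRingType) (Y : ind_affine R) : Prop :=
  exists Y' : ind_affine R,
    (forall j : ind_index Y', flat_algebra (ind_alg j)) /\
    functor_iso (ind_functor Y) (ind_functor Y').

(* A((t)) = A[[t]][t^-1]: formal sums of a_i t^i over i : int with a_i = 0    *)
(* for i below some bound.                                                    *)
Record laurent (A : comPzRingType) := Laurent {
  lcoef :> int -> A;
  lbound : exists d : int, forall i, i < d -> lcoef i = 0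
}.

Section LaurentRing.
Variable A : comPzRingType.
Implicit Types f g h : laurent A.

Lemma laurent_ext f g : f =1 g -> f = g.
Proof.
case: f g => [f fb] [g gb] /= /funext fg.
by case: g / fg in gb *; rewrite (Prop_irrelevance fb gb).
Qed.

HB.instance Definition _ := gen_eqMixin (laurent A).
HB.instance Definition _ := gen_choiceMixin (laurent A).

Lemma lbound2 f g :
  exists d : int, forall i, i < d -> f i = 0 /\ g i = 0.
Proof.
have [d fd] := lbound f; have [e ge] := lbound g.
by exists (Num.min d e) => i; rewrite lt_min => /andP[/fd -> /ge ->].
Qed.

Definition lzero : laurent A :=
  @Laurent A (fun=> 0) (ex_intro _ 0 (fun _ _ => erefl)).

Lemma lopp_subproof f : exists d : int, forall i, i < d -> - f i = 0.
Proof. by have [d fd] := lbound f; exists d => i /fd ->; rewrite oppr0. Qed.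

Definition lopp f : laurent A := Laurent (lopp_subproof f).

Lemma ladd_subproof f g : exists d : int, forall i, i < d -> f i + g i = 0.
Proof.
by have [d fgd] := lbound2 f g; exists d => i /fgd[-> ->]; rewrite addr0.
Qed.

Definition ladd f g : laurent A := Laurent (ladd_subproof f g).

Lemma laddA : associative ladd.
Proof. by move=> f g h; apply: laurent_ext => i; apply: addrA. Qed.

Lemma laddC : commutative ladd.
Proof. by move=> f g; apply: laurent_ext => i; apply: addrC. Qed.

Lemma ladd0 : left_id lzero ladd.
Proof. by move=> f; apply: laurent_ext => i; apply: add0r. Qed.

Lemma laddN : left_inverse lzero lopp ladd.
Proof. by move=> f; apply: laurent_ext => i; apply: addNr. Qed.

HB.instance Definition _ :=
  GRing.isZmodule.Build (laurent A) laddA laddC ladd0 laddN.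

(* This sum over int has finitely many nonzero terms, so it is not the       *)
(* default value 0 of [fsbigop].                                              *)
Definition lconv f g (m : int) : A := \sum_(i \in [set: int]) f i * g (m - i).

Lemma lconvE f g m (r : seq int) : uniq r ->
    (forall i, i \notin r -> f i * g (m - i) = 0) ->
  lconv f g m = \sum_(i <- r) f i * g (m - i).
Proof. move=> r_uniq r0; rewrite /lconv (fsbigE r) //; last by move=> i _; apply: r0.
by apply: eq_bigl => i; rewrite in_setT. Qed.

Definition lrange (K : nat) : seq int :=
  [seq i%:Z - K%:Z | i <- iota 0 (K + K).+1].

Lemma lrange_uniq K : uniq (lrange K).
Proof. by rewrite map_inj_uniq ?iota_uniq // => i j /addIr[]. Qed.

Lemma mem_lrange K (i : int) : (i \in lrange K) = (- K%:Z <= i <= K%:Z).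
Proof.
apply/mapP/idP => [[j]|]; first by rewrite mem_iota; lia.
move=> Ki; exists `|(i + K%:Z)%R|%N; last by lia.
by rewrite mem_iota; lia.
Qed.

Lemma lconv_range f g (m d : int) (K : nat) :
    (forall i, i < d -> f i = 0) -> (forall i, i < d -> g i = 0) ->
    (`|d| + `|m| <= K)%N ->
  lconv f g m = \sum_(i <- lrange K) f i * g (m - i).
Proof.
move=> fd gd dK; apply: lconvE; first exact: lrange_uniq.
move=> i; rewrite mem_lrange => iK.
have [/fd ->|di] := ltP i d; first by rewrite mul0r.
by rewrite gd ?mulr0//; lia.
Qed.

Lemma lmul_subproof f g : exists d : int, forall m, m < d -> lconv f g m = 0.
Proof.
have [d fgd] := lbound2 f g; exists (d + d) => m md.
apply: fsbig1 => i _; have [/fgd[-> _]|di] := ltP i d; first exact: mul0r.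
by have [_ ->] : f (m - i) = 0 /\ g (m - i) = 0; [apply: fgd; lia|apply: mulr0].
Qed.

Definition lmul f g : laurent A := Laurent (lmul_subproof f g).

Lemma lone_subproof : exists d : int, forall i : int,
  i < d -> (i == 0)%:R = 0 :> A.
Proof. by exists 0 => i; case: eqP => // ->. Qed.

Definition lone : laurent A := Laurent lone_subproof.

Lemma lmulC : commutative lmul.
Proof.
move=> f g; apply: laurent_ext => m /=; rewrite /lconv.
have mB : bijective (fun i : int => m - i).
  by exists (fun i : int => m - i) => i; apply: subKr.
rewrite [LHS](reindex_fsbigT _ _ mB).
by apply: eq_fsbigr => i _; rewrite subKr mulrC.
Qed.

Lemma lmul1 : left_id lone lmul.
Proof.
move=> f; apply: laurent_ext => m /=.
rewrite (@lconvE lone f m [:: 0]) //= ?big_seq1 ?eqxx ?mul1r ?subr0 //.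
by move=> i; rewrite inE => /negPf ->; apply: mul0r.
Qed.

Lemma lmulDl : left_distributive lmul ladd.
Proof.
move=> f g h; apply: laurent_ext => m /=.
have [d fgd] := lbound2 f g; have [e he] := lbound h.
pose c := Num.min d e.
have fc i : i < c -> f i = 0 by rewrite lt_min => /andP[/fgd[]].
have gc i : i < c -> g i = 0 by rewrite lt_min => /andP[/fgd[]].
have hc i : i < c -> h i = 0 by rewrite lt_min => /andP[_ /he].
have fgc i : i < c -> ladd f g i = 0 by move=> ic; rewrite /= fc ?gc ?addr0.
rewrite (lconv_range fgc hc (leqnn _)) (lconv_range fc hc (leqnn _)).
rewrite (lconv_range gc hc (leqnn _)).
by rewrite -big_split; apply: eq_bigr => i _; rewrite mulrDl.
Qed.

Lemma lmulA : associative lmul.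
Proof.
move=> f g h; apply: laurent_ext => m /=.
have [d fgd] := lbound2 f g; have [e he] := lbound h.
pose c := Num.min d e.
have fc i : i < c -> f i = 0 by rewrite lt_min => /andP[/fgd[]].
have gc i : i < c -> g i = 0 by rewrite lt_min => /andP[/fgd[]].
have hc i : i < c -> h i = 0 by rewrite lt_min => /andP[_ /he].
pose K := (3 * `|c| + `|m|)%N.
have convc (u v : laurent A) (k : int) : (forall i, i < c -> u i = 0) ->
    (forall i, i < c -> v i = 0) -> k < c + c -> lconv u v k = 0.
  move=> uc vc kc; apply: fsbig1 => i _.
  have [/uc ->|ci] := ltP i c; first exact: mul0r.
  by rewrite vc ?mulr0 //; lia.
transitivity (\sum_(i <- lrange K) \sum_(k <- lrange K)
    f i * (g (k - i) * h (m - k))).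
  rewrite (@lconvE f (lmul g h) m (lrange K)); first last.
  - move=> i; rewrite mem_lrange => iK.
    have [/fc ->|ci] := ltP i c; first exact: mul0r.
    by rewrite /= convc ?mulr0 //; lia.
  - exact: lrange_uniq.
  apply: eq_bigr => i _; have [/fc ->|ci] := ltP i c.
    by rewrite mul0r big1 // => k _; rewrite mul0r.
  rewrite -mulr_sumr /=; congr (_ * _).
  rewrite (@lconvE g h (m - i) [seq k - i | k <- lrange K]); first last.
  - move=> j; have [/gc ->|cj] := ltP j c; first by rewrite mul0r.
    rewrite -{1}(addrK i j) (mem_map (addIr (- i))) mem_lrange => jK.
    by rewrite hc ?mulr0 //; lia.
  - by rewrite map_inj_uniq ?lrange_uniq //; apply: addIr.
  by rewrite big_map; apply: eq_bigr => k _; congr (_ * h _); lia.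
rewrite exchange_big /= (@lconvE (lmul f g) h m (lrange K)); first last.
- move=> k; rewrite mem_lrange => kK.
  have [/(convc f g _ fc gc)/= ->|ck] := ltP k (c + c); first exact: mul0r.
  by rewrite hc ?mulr0 //; lia.
- exact: lrange_uniq.
apply: eq_bigr => k _; have [mk|mk] := ltP (m - k) c.
  by rewrite hc // mulr0 big1 // => i _; rewrite !mulr0.
rewrite /= (@lconvE f g k (lrange K)); first last.
- move=> i; rewrite mem_lrange => iK.
  have [/fc ->|ci] := ltP i c; first exact: mul0r.
  by rewrite gc ?mulr0 //; lia.
- exact: lrange_uniq.
by rewrite mulr_suml; apply: eq_bigr => i _; rewrite mulrA.
Qed.

HB.instance Definition _ := GRing.Zmodule_isComPzRing.Build (laurent A)
  lmulA lmulC lmul1 lmulDl.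

End LaurentRing.

Section LaurentMap.
Variables (A B : comPzRingType) (u : {rmorphism A -> B}).

Lemma lmap_subproof (f : laurent A) :
  exists d : int, forall i, i < d -> u (f i) = 0.
Proof. by have [d fd] := lbound f; exists d => i /fd ->; rewrite rmorph0. Qed.

Definition lmap (f : laurent A) : laurent B := Laurent (lmap_subproof f).

Lemma lmap_is_zmod_morphism : zmod_morphism lmap.
Proof. by move=> f g; apply: laurent_ext => i; apply: rmorphB. Qed.

Lemma lmap_is_monoid_morphism : monoid_morphism lmap.
Proof.
split=> [|f g]; apply: laurent_ext => m /=; first by rewrite rmorph_nat.
have [d fgd] := lbound2 f g.
have fd i : i < d -> f i = 0 by case/fgd.
have gd i : i < d -> g i = 0 by case/fgd.
have ufd i : i < d -> lmap f i = 0 by move=> /fd /= ->; apply: rmorph0.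
have ugd i : i < d -> lmap g i = 0 by move=> /gd /= ->; apply: rmorph0.
rewrite (lconv_range fd gd (leqnn _)) (lconv_range ufd ugd (leqnn _)).
by rewrite rmorph_sum; apply: eq_bigr => i _; rewrite rmorphM.
Qed.

HB.instance Definition _ :=
  GRing.isZmodMorphism.Build (laurent A) (laurent B) lmap lmap_is_zmod_morphism.
HB.instance Definition _ :=
  GRing.isMonoidMorphism.Build (laurent A) (laurent B) lmap
    lmap_is_monoid_morphism.

End LaurentMap.

(* A((t_1))...((t_n)); the outermost variable is t_n *)
Fixpoint iter_laurent (n : nat) (A : comPzRingType) : comPzRingType :=
  if n is n'.+1 then laurent (iter_laurent n' A) else A.

Fixpoint iter_lmap (n : nat) (A B : comPzRingType) (u : {rmorphism A -> B}) :
    {rmorphism iter_laurent n A -> iter_laurent n B} :=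
  if n is n'.+1 then lmap (iter_lmap n' u) else u.

Lemma iter_lmap_id n (A : comPzRingType) :
  iter_lmap n (idfun : {rmorphism A -> A}) =1 id.
Proof.
by elim: n => [|n IHn] //= f; apply: laurent_ext => i; apply: IHn.
Qed.

Lemma iter_lmap_comp n (A B C : comPzRingType) (v : {rmorphism B -> C})
    (u : {rmorphism A -> B}) :
  iter_lmap n (v \o u : {rmorphism A -> C}) =1 iter_lmap n v \o iter_lmap n u.
Proof.
by elim: n => [|n IHn] //= f; apply: laurent_ext => i; apply: IHn.
Qed.

(* The group A^*.  The library's [GRing.unit] needs a unit ring structure,    *)
(* which laurent rings do not carry.                                          *)
Definition units (A : comPzRingType) : Type :=
  {x : A | exists y : A, y * x = 1}.

Lemma units_ext (A : comPzRingType) (x y : units A) : sval x = sval y -> x = y.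
Proof.
case: x y => [x xu] [y yu] /= xy.
by case: y / xy in yu *; rewrite (Prop_irrelevance xu yu).
Qed.

Lemma units_map_subproof (A B : comPzRingType) (u : {rmorphism A -> B})
    (x : units A) : exists y : B, y * u (sval x) = 1.
Proof.
by have [y yx] := svalP x; exists (u y); rewrite -rmorphM yx rmorph1.
Qed.

Definition units_map (A B : comPzRingType) (u : {rmorphism A -> B})
    (x : units A) : units B := exist _ (u (sval x)) (units_map_subproof u x).

Section LGm.
Variable n : nat.

Lemma LGm_id (A : comPzRingType) (x : units (iter_laurent n A)) :
  units_map (iter_lmap n (idfun : {rmorphism A -> A})) x = x.
Proof. by apply: units_ext; apply: iter_lmap_id. Qed.

Lemma LGm_comp (A B C : comPzRingType) (v : {rmorphism B -> C})
    (u : {rmorphism A -> B}) (x : units (iter_laurent n A)) :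
  units_map (iter_lmap n (v \o u : {rmorphism A -> C})) x =
  units_map (iter_lmap n v) (units_map (iter_lmap n u) x).
Proof. by apply: units_ext; apply: iter_lmap_comp. Qed.

Definition LGm : ring_functor :=
  @RingFunctor (fun A => units (iter_laurent n A))
    (fun A B u => units_map (iter_lmap n u)) LGm_id LGm_comp.

End LGm.

(* Main.v *)
(* A unit of A((t_1))...((t_n)) over a ring A with connected spectrum is a    *)
(* sum g + h, where the lexicographically lowest coefficient of g is a unit   *)
(* and h is nilpotent. The ring that carries the universal such pair is not   *)
(* flat in general, since the nilpotency of h is not a condition on single    *)
(* coefficients. But g + h is the value at z = 1 of the unit g + z h over     *)
(* A[z], and A[z] embeds into the product of the A[z]/z^K; over A[z]/z^K, g + *)
(* z h lifts to a unit over a ring B that is free over D, where the point of  *)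
(* Y comes from the flat R-algebra D. As B embeds into an S-algebra, two      *)
(* transformations that agree over S-algebras agree at the lift, hence at g + *)
(* h. The case of an arbitrary A follows, because a nonzero element of A      *)
(* survives in some quotient of A with connected spectrum.                    *)

From HB Require Import structures.
Require Import Defs.
From mathcomp Require Import all_boot all_order all_algebra generic_quotient.
From mathcomp Require Import boolp classical_sets.
From mathcomp Require Import zify ring.

Set Implicit Arguments.
Unset Strict Implicit.
Unset Printing Implicit Defensive.

Import Order.TTheory GRing.Theory Num.Theory.
Local Open Scope ring_scope.
Local Open Scope quotient_scope.

(** * Units and nilpotents of Laurent series rings *)

(** By assumption the two transformations agree at every point over an S-algebra. Agreement passes
    along every homomorphism of R-algebras ([agree_push]) and, since Z is affine, can be tested
    after homomorphisms that jointly separate elements ([agree_pull]). So it suffices to link an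
    arbitrary point by such moves to points over S-algebras.

    Testing on quotients reduces to a connected A ([exists_connected_quotient]). There each unit is
    g + h by [unit_lead_nilpotent_decomp], which rests on [connected_laurent] and
    [laurent_unit_lead]. The point is the image under z = 1 of the point g + z h over A[z], which is
    tested in every A[z]/z^K ([trunc_jointly_injective]). Over A[z]/z^K it is the image of a point
    over a D-free ring B ([deform_trunc_lift]): coefficients a lift to symbols [a] with [0] = 0 and
    [a b] = [a] [b], so leading units stay units, and the nilpotency of z replaces that of h.
    Finally D embeds into S (x) D by flatness ([tensor_inr_injective]), hence B into the ring built
    in the same way from S (x) D ([malg_map_injective]), an S-algebra. *)

Definition is_unit (A : comPzRingType) (x : A) : Prop := exists y, y * x = 1.

Definition nilpotent (A : comPzRingType) (x : A) : Prop :=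
  exists k, x ^+ k = 0.

Section UnitsNilpotents.
Variable A : comPzRingType.
Implicit Types x y : A.

Lemma is_unitM x y : is_unit x -> is_unit y -> is_unit (x * y).
Proof.
by move=> [u ux] [v vy]; exists (u * v); rewrite mulrACA ux vy mulr1.
Qed.

Lemma is_unit_factor x y : is_unit (x * y) -> is_unit x.
Proof. by move=> [u uxy]; exists (u * y); rewrite -mulrA [y * x]mulrC. Qed.

Lemma nilpotent0 : nilpotent (0 : A).
Proof. by exists 1%N. Qed.

Lemma nilpotentMl x y : nilpotent y -> nilpotent (x * y).
Proof. by move=> [k yk]; exists k; rewrite exprMn yk mulr0. Qed.

Lemma nilpotentMr x y : nilpotent x -> nilpotent (x * y).
Proof. by rewrite mulrC; apply: nilpotentMl. Qed.

Lemma nilpotentN x : nilpotent x -> nilpotent (- x).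
Proof. by rewrite -mulN1r; apply: nilpotentMl. Qed.

Lemma nilpotentD x y : nilpotent x -> nilpotent y -> nilpotent (x + y).
Proof.
move=> [k xk] [l yl]; exists (k + l)%N; rewrite exprDn big1 // => i _.
have [il|li] := leqP i l.
  suff -> : x ^+ (k + l - i) = 0 by rewrite mul0r mul0rn.
  by rewrite -addnBA // exprD xk mul0r.
suff -> : y ^+ i = 0 by rewrite mulr0 mul0rn.
by rewrite -(subnK (ltnW li)) exprD yl mulr0.
Qed.

Lemma nilpotent_sum I (r : seq I) (P : pred I) (F : I -> A) :
  (forall i, P i -> nilpotent (F i)) -> nilpotent (\sum_(i <- r | P i) F i).
Proof.
move=> FP; elim/big_rec: _ => [|i x Pi nx]; first exact: nilpotent0.
exact: nilpotentD (FP i Pi) nx.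
Qed.

Lemma nilpotent_sqr x : nilpotent (x * x) -> nilpotent x.
Proof. by move=> [k]; rewrite -expr2 -exprM => xk; exists (2 * k)%N. Qed.

Lemma nilpotent_unitM x y : is_unit x -> nilpotent (x * y) -> nilpotent y.
Proof. by move=> [u ux] /(nilpotentMl u); rewrite mulrA ux mul1r. Qed.

Lemma unit_sub1_nilpotent x : nilpotent x -> is_unit (1 - x).
Proof.
move=> [k xk]; exists (\sum_(i < k) x ^+ i).
by rewrite mulrC -[LHS]opprK -mulNr opprB -subrX1 xk sub0r opprK.
Qed.

Lemma unitD_nilpotent x y : is_unit x -> nilpotent y -> is_unit (x + y).
Proof.
move=> [u ux] ny; have -> : x + y = x * (1 - - (u * y)).
  by rewrite opprK mulrDr mulr1 mulrA [x * u]mulrC ux mul1r.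
apply: is_unitM; first by exists u.
exact/unit_sub1_nilpotent/nilpotentN/nilpotentMl.
Qed.

End UnitsNilpotents.

Lemma is_unit_morph (A B : comPzRingType) (u : {rmorphism A -> B}) x :
  is_unit x -> is_unit (u x).
Proof. by move=> [y yx]; exists (u y); rewrite -rmorphM yx rmorph1. Qed.

Lemma nilpotent_morph (A B : comPzRingType) (u : {rmorphism A -> B}) x :
  nilpotent x -> nilpotent (u x).
Proof. by move=> [k xk]; exists k; rewrite -rmorphXn xk rmorph0. Qed.

(* Spec A has no nontrivial open and closed subset, put in a form that makes  *)
(* the lifting of idempotents along nilpotents unnecessary.                   *)
Definition connected_ring (A : comPzRingType) : Prop :=
  forall x y : A, x + y = 1 -> nilpotent (x * y) -> nilpotent x \/ nilpotent y.

Section Laurent.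
Variable A : comPzRingType.
Implicit Types (f g : laurent A) (i j d e m : int).

Lemma lcoefD f g i : (f + g) i = f i + g i. Proof. by []. Qed.
Lemma lcoefN f i : (- f) i = - f i. Proof. by []. Qed.
Lemma lcoef1 i : (1 : laurent A) i = (i == 0)%:R. Proof. by []. Qed.
Lemma lcoefM f g i : (f * g) i = lconv f g i. Proof. by []. Qed.

Lemma lcoef_sum I (r : seq I) (P : pred I) (F : I -> laurent A) i :
  (\sum_(j <- r | P j) F j) i = \sum_(j <- r | P j) F j i.
Proof. by elim/big_rec2: _ => // j y1 y2 _ <-. Qed.

Definition lvanish f d : Prop := forall i, i < d -> f i = 0.

Lemma lvanishM f g d e : lvanish f d -> lvanish g e ->
  lvanish (f * g) (d + e) /\ (f * g) (d + e) = f d * g e.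
Proof.
move=> fd ge.
have fg m i : m < d + e -> f i * g (m - i) = 0.
  move=> mde; have [/fd ->|di] := ltP i d; first exact: mul0r.
  by rewrite ge ?mulr0 //; lia.
split=> [m mde|].
  by rewrite lcoefM (@lconvE _ _ _ _ [::]) ?big_nil // => i _; apply: fg.
rewrite lcoefM (@lconvE _ _ _ _ [:: d]) ?big_seq1 ?[d + e]addrC ?addrK // => i.
rewrite inE neq_lt => /orP[/fd ->|di]; first exact: mul0r.
by rewrite ge ?mulr0 //; lia.
Qed.

Lemma lvanishX f d k : lvanish f d ->
  lvanish (f ^+ k) (d *+ k) /\ (f ^+ k) (d *+ k) = f d ^+ k.
Proof.
move=> fd; elim: k => [|k [IH1 IH2]].
  rewrite mulr0n !expr0; split=> // i i0; rewrite lcoef1.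
  by case: eqP i0 => // ->.
rewrite mulrS exprS; have [H1 H2] := lvanishM fd IH1; split=> //.
by rewrite H2 IH2 -exprS.
Qed.

Lemma nilpotent_lead f d : lvanish f d -> nilpotent f -> nilpotent (f d).
Proof.
by move=> fd [k fk]; exists k; have [_ <-] := lvanishX k fd; rewrite fk.
Qed.

Lemma lmono_subproof i (a : A) :
  exists d : int, forall j, j < d -> (if j == i then a else 0) = 0.
Proof. by exists i => j; case: eqP => // ->; rewrite ltxx. Qed.

Definition lmono i a : laurent A := Laurent (lmono_subproof i a).

Lemma lmono_coefM i a f j : (lmono i a * f) j = a * f (j - i).
Proof.
rewrite lcoefM (@lconvE _ _ _ _ [:: i]) ?big_seq1 //= ?eqxx // => k.
by rewrite inE => /negPf ->; apply: mul0r.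
Qed.

Lemma lmonoM i j a b : lmono i a * lmono j b = lmono (i + j) (a * b).
Proof.
apply: laurent_ext => k; rewrite lmono_coefM /= subr_eq addrC.
by case: ifP => // _; rewrite mulr0.
Qed.

Lemma lmonoX i a k : lmono i a ^+ k = lmono (i *+ k) (a ^+ k).
Proof.
elim: k => [|k IH]; last by rewrite exprS IH lmonoM -mulrS -exprS.
by apply: laurent_ext => j; rewrite lcoef1 mulr0n /=; case: eqP.
Qed.

Lemma nilpotent_lmono i a : nilpotent a -> nilpotent (lmono i a).
Proof.
move=> [k ak]; exists k; rewrite lmonoX ak.
by apply: laurent_ext => j /=; case: ifP.
Qed.

Definition lconst (a : A) : laurent A := lmono 0 a.

Lemma lconst_is_zmod_morphism : zmod_morphism lconst.
Proof.
move=> a b; apply: laurent_ext => j; rewrite lcoefD lcoefN /=.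
by case: ifP; rewrite ?subr0.
Qed.

Lemma lconst_is_monoid_morphism : monoid_morphism lconst.
Proof.
split=> [|a b]; first by apply: laurent_ext => j; rewrite lcoef1 /=; case: eqP.
by rewrite lmonoM addr0.
Qed.

HB.instance Definition _ :=
  GRing.isZmodMorphism.Build A (laurent A) lconst lconst_is_zmod_morphism.
HB.instance Definition _ :=
  GRing.isMonoidMorphism.Build A (laurent A) lconst lconst_is_monoid_morphism.

(** Allows an infinite series to be replaced by a truncation when one coefficient of its product
    with a power series is computed. *)
Lemma lvanish_eqM f f' g d : (forall i, i < d -> f i = f' i) -> lvanish g 0 ->
  forall i, i < d -> (f * g) i = (f' * g) i.
Proof.
move=> ff g0 i id; apply/eqP; rewrite -subr_eq0 -lcoefN -lcoefD -mulrBl.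
have ffd : lvanish (f - f') d.
  by move=> j jd; rewrite lcoefD lcoefN ff ?subrr.
have [H _] := lvanishM ffd g0; apply/eqP/H.
by rewrite addr0.
Qed.

(* The geometric series, truncated at order [i] to get the coefficient [i].   *)
Lemma unit_sub1_pos f : lvanish f 1 -> is_unit (1 - f).
Proof.
move=> f1; pose G k := \sum_(j < k) f ^+ j.
have fX k i : i < k%:Z -> (f ^+ k) i = 0.
  by move=> ik; have [H _] := lvanishX k f1; apply: H; rewrite -natz in ik.
have Gstep k i : i < k%:Z -> G k.+1 i = G k i.
  by move=> ik; rewrite /G big_ord_recr lcoefD fX // addr0.
have Gst k l i : i < k%:Z -> (k <= l)%N -> G l i = G k i.
  move=> ik; elim: l => [|l IH]; first by rewrite leqn0 => /eqP->.
  by rewrite leq_eqVlt => /orP[/eqP-> //|kl]; rewrite Gstep ?IH //; lia.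
(* The coefficient of order i is read off from the first i + 1 powers of f; the maximum with -1
   yields the empty sum for i < 0. *)
have gP : exists d : int,
    forall i, i < d -> G `|(Num.max i (-1) + 1)%R|%N i = 0.
  exists 0 => i i0; have -> : Num.max i (-1) + 1 = 0 by lia.
  by rewrite /G big_ord0.
exists (Laurent gP); apply: laurent_ext => i.
pose K := `|i|.+1%N.
have f0 : lvanish (1 - f) 0.
  move=> j j0; rewrite lcoefD lcoefN lcoef1 f1; last by lia.
  by case: eqP j0 => [->|]; rewrite ?subr0.
rewrite (@lvanish_eqM _ (G K) _ K%:Z) //; last by rewrite /K; lia.
  have -> : G K * (1 - f) = 1 - f ^+ K.
    by rewrite mulrC -[LHS]opprK -mulNr opprB -subrX1 opprB.
  by rewrite lcoefD lcoefN fX ?subr0 // /K; lia.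
by move=> j jK /=; apply/esym/Gst; lia.
Qed.

Lemma unit_lead f d : lvanish f d -> is_unit (f d) -> is_unit f.
Proof.
move=> fd [v vf]; apply: (@is_unit_factor _ f (lmono (- d) v)).
suff -> : f * lmono (- d) v = 1 - (1 - lmono (- d) v * f).
  apply: unit_sub1_pos => i i1; rewrite lcoefD lcoefN lmono_coefM opprK lcoef1.
  have [->|i0] := eqVneq i 0; first by rewrite add0r vf subrr.
  by rewrite fd ?mulr0 ?subr0 //; lia.
by rewrite subKr mulrC.
Qed.

(** As f is bounded below, its part of order below m is a finite sum of monomials; finiteness is
    what carries nilpotency from the coefficients to this part. *)
Lemma lsplit f m : exists h : laurent A, [/\ forall i, i < m -> h i = f i,
  forall i, m <= i -> h i = 0 &
  (forall i, i < m -> nilpotent (f i)) -> nilpotent h].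
Proof.
have [d fd] := Defs.lbound f.
pose r := [seq d + k%:Z | k <- iota 0 `|(m - d)%R|%N].
have memr i : i \in r -> d <= i.
  by move=> /mapP[j _ ->]; lia.
pose h := \sum_(i <- r | i < m) lmono i (f i).
exists h; have hi i : h i = if (i \in r) && (i < m) then f i else 0.
  rewrite /h lcoef_sum /=; under eq_bigr do rewrite eq_sym.
  have ru : uniq r by rewrite map_inj_uniq ?iota_uniq // => a b /addrI[].
  rewrite -big_mkcondr /=; case: ifP => [/andP[ir im]|irm].
    rewrite (big_rem i) //= eqxx im /= big_seq_cond big1 ?addr0 // => j.
    by rewrite mem_rem_uniq // inE; case: eqP => //= _; rewrite !andbF.
  rewrite big_seq_cond big1 // => j /and3P[jr jm /eqP ji].
  by rewrite -ji jr jm in irm.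
split=> [i im|i mi|fnil]; rewrite ?hi ?im.
- rewrite andbT; case: ifP => // /negP ir; case: (ltP i d) => [/fd //|di].
  case: ir; apply/mapP; exists `|i - d|%N; last by lia.
  by rewrite mem_iota; lia.
- by rewrite ltNge mi andbF.
- by apply: nilpotent_sum => i im; apply/nilpotent_lmono/fnil.
Qed.

(* Multiplying the coefficient of order i + j of f * g by f i * g j gives (f  *)
(* i * g j)^2 plus terms that have a factor f k * g l with k + l < i + j.     *)
Lemma nilpotent_lowcoef f g m : (forall i, i < m -> (f * g) i = 0) ->
  forall i j, i + j < m -> nilpotent (f i * g j).
Proof.
move=> fg0; have [c fgc] := lbound2 f g.
have fc i : i < c -> f i = 0 by case/fgc.
have gc i : i < c -> g i = 0 by case/fgc.
suff H n i j : i + j < m -> `|(i + j - c - c)%R|%N = n -> nilpotent (f i * g j).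
  by move=> i j ijm; apply: H ijm (erefl _).
elim/ltn_ind: n i j => n IHn i j ijm en.
have [/fc ->|ci] := ltP i c; first by rewrite mul0r; apply: nilpotent0.
have [/gc ->|cj] := ltP j c; first by rewrite mulr0; apply: nilpotent0.
apply: nilpotent_sqr.
pose K := (`|c| + `|(i + j)%R|)%N.
have := fg0 _ ijm; rewrite lcoefM (lconv_range fc gc (leqnn _)) -/K.
have iK : i \in lrange K by rewrite mem_lrange; lia.
rewrite (big_rem i) //= [i + j]addrC addrK => /eqP; rewrite addr_eq0 => /eqP e.
rewrite {1}e mulNr; apply: nilpotentN; rewrite mulr_suml big_seq_cond.
apply: nilpotent_sum => k; rewrite andbT (mem_rem_uniq _ (lrange_uniq K)) inE.
case/andP=> ki kK; case: (ltP k c) => [/fc ->|ck].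
  by rewrite !mul0r; apply: nilpotent0.
have [/gc ->|ck'] := ltP (j + i - k) c.
  by rewrite mulr0 mul0r; apply: nilpotent0.
(* The factors regroup as f k * g j and f i * g (i + j - k). Their orders have sum 2 (i + j) and
   differ because k is not i, so one of them is below i + j. *)
rewrite [f i * g j]mulrC mulrACA; have [ltki|leik] := ltP k i.
  by apply: nilpotentMr; apply: IHn (erefl _); lia.
by apply: nilpotentMl; rewrite mulrC; apply: IHn (erefl _); lia.
Qed.

Lemma nilpotent_sub_unit (x y : A) :
  x + y = 1 -> nilpotent y -> is_unit x.
Proof.
by move=> /eqP; rewrite eq_sym -subr_eq => /eqP <- /unit_sub1_nilpotent.
Qed.

Hypothesis A_conn : connected_ring A.

(* After subtracting the nilpotent terms of negative order from x, and adding *)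
(* them to y, x and y are power series; if moreover the constant coefficient  *)
(* of x is nilpotent, y is a unit up to nilpotents.                           *)
Lemma connected_laurent : connected_ring (laurent A).
Proof.
move=> x y xy1 nxy.
have [d xd] := Defs.lbound x.
(* Once the coefficients of x below i are known to be nilpotent, they are moved from x to y. Both
   series then vanish below i, and since i < 0 their coefficients at i are opposite, so the product
   has lowest coefficient - (x i)^2, at order 2 i. *)
have xneg i : i < 0 -> nilpotent (x i).
  have [n] := ubnP `|(i - d)%R|%N; elim: n i => // n IHn i ltn i0.
  have [/xd ->|di] := ltP i d; first exact: nilpotent0.
  have [h [hx h0 nh]] := lsplit x i.
  have {}nh : nilpotent h.
    apply: nh => j ji; have [/xd ->|dj] := ltP j d; first exact: nilpotent0.
    by apply: IHn; lia.
  have x'i : lvanish (x - h) i.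
    by move=> j ji; rewrite lcoefD lcoefN hx ?subrr.
  have y'E : y + h = 1 - (x - h) by rewrite opprB addrA addrAC -xy1; ring.
  have y'i : lvanish (y + h) i.
    move=> j ji; rewrite y'E lcoefD lcoefN x'i // subr0 lcoef1.
    by case: eqP => // j0; lia.
  have nx'y' : nilpotent ((x - h) * (y + h)).
    have -> : (x - h) * (y + h) = x * y + h * (x - y - h) by ring.
    by apply: nilpotentD => //; apply: nilpotentMr.
  have [v e] := lvanishM x'i y'i.
  have y'iE : (y + h) i = - (x - h) i.
    by rewrite y'E [LHS]lcoefD lcoefN lcoef1 lt_eqF // sub0r.
  have := nilpotent_lead v nx'y'; rewrite e y'iE mulrN => /nilpotentN.
  rewrite opprK => /nilpotent_sqr.
  by rewrite lcoefD lcoefN h0 ?subr0.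
have [h [hx h0 /(_ xneg) nh]] := lsplit x 0.
pose x' := x - h; pose y' := y + h.
have xy' : x' + y' = 1 by rewrite -xy1 /x' /y'; ring.
have nxy' : nilpotent (x' * y').
  have -> : x' * y' = x * y + h * (x - y - h) by rewrite /x' /y'; ring.
  by apply: nilpotentD => //; apply: nilpotentMr.
have vx' : lvanish x' 0 by move=> j ji; rewrite lcoefD lcoefN hx ?subrr.
have vy' : lvanish y' 0.
  have -> : y' = 1 - x' by rewrite -xy'; ring.
  move=> j ji; rewrite lcoefD lcoefN vx' // subr0 lcoef1.
  by case: eqP => // j0; lia.
have [v e] := lvanishM vx' vy'.
have := nilpotent_lead v nxy'; rewrite e => /(A_conn _).
(* With c the constant term of u and u' = u - c, the product (1 - u') u' equals u w up to a multiple
   of the nilpotent c, and 1 - u' is a unit because u' has positive order. *)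
have main (u w : laurent A) : u + w = 1 -> lvanish u 0 -> nilpotent (u * w) ->
    nilpotent (u 0) -> nilpotent u.
  move=> uw u0 nuw nu0.
  pose u' := u - lconst (u 0).
  have uu' : u = u' + lconst (u 0) by rewrite subrK.
  have vu' : lvanish u' 1.
    move=> j j1; rewrite lcoefD lcoefN /=; case: eqP => [->|j0].
      by rewrite subrr.
    by rewrite u0 ?subr0 //; lia.
  have nc : nilpotent (lconst (u 0)) by apply: nilpotent_lmono.
  rewrite uu'; apply: nilpotentD => //.
  apply: (nilpotent_unitM (unit_sub1_pos vu')).
  have -> : (1 - u') * u' = u * w + lconst (u 0) * (u - w - lconst (u 0)).
    by rewrite -uw /u'; ring.
  by apply: nilpotentD => //; apply: nilpotentMr.
case.
- by rewrite -[x' 0 + y' 0]/((x' + y') 0) xy'.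
- move=> /(main _ _ xy' vx' nxy') nx'; left.
  by rewrite -(subrK h x); apply: nilpotentD.
- rewrite mulrC in nxy'; rewrite addrC in xy'.
  move=> /(main _ _ xy' vy' nxy') ny'; right.
  by rewrite -(addrK h y); apply: nilpotentD => //; apply: nilpotentN.
Qed.

(* If g is the inverse of f, the products f i * g (- i) sum to 1 and the      *)
(* product of any two of them is nilpotent; as A is connected, one of them is *)
(* a unit.                                                                    *)
Lemma laurent_unit_lead f : is_unit f ->
  exists m, (forall i, i < m -> nilpotent (f i)) /\ is_unit (f m).
Proof.
move=> [g gf]; rewrite mulrC in gf.
have low := @nilpotent_lowcoef f g 0.
have {}low i j : i + j < 0 -> nilpotent (f i * g j).
  by apply: low => k k0; rewrite gf lcoef1 lt_eqF.
have [c fgc] := lbound2 f g.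
have fc i : i < c -> f i = 0 by case/fgc.
have gc i : i < c -> g i = 0 by case/fgc.
have := lcoefM f g 0; rewrite gf lcoef1 eqxx (lconv_range fc gc (leqnn _)).
set r := lrange _ => e1.
have [[m [mr um]]|nall] :=
  pselect (exists m, m \in r /\ is_unit (f m * g (0 - m))).
  exists m; split; last exact: is_unit_factor um.
  move=> i im; have um' : is_unit (g (0 - m)).
    by move: um; rewrite mulrC; apply: is_unit_factor.
  by apply: (nilpotent_unitM um'); rewrite mulrC; apply: low; lia.
(* If no product f i * g (- i) is a unit, connectedness makes each of them nilpotent, hence also
   their sum 1. Then A is the zero ring, where m = 0 will do. *)
suff [k] : nilpotent (1 : A).
  rewrite expr1n => A0; exists 0; split=> [i _|].
    by exists 1%N; rewrite -[LHS]mul1r A0 mul0r.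
  by exists 0; rewrite A0 mul0r.
rewrite [X in nilpotent X]e1 big_seq_cond; apply: nilpotent_sum => i.
rewrite andbT => ir.
move: (e1); rewrite (big_rem i) //= => /esym e2.
have [|//|nrest] := A_conn e2; last first.
  by case: nall; exists i; split=> //; apply: nilpotent_sub_unit e2 nrest.
rewrite mulr_sumr big_seq_cond; apply: nilpotent_sum => k.
rewrite andbT (mem_rem_uniq _ (lrange_uniq _)) inE => /andP[ki _].
rewrite [f k * _]mulrC mulrACA; have [ltki|leik] := ltP k i.
  by apply: nilpotentMl; rewrite mulrC; apply: low; lia.
by apply: nilpotentMr; apply: low; lia.
Qed.

End Laurent.

(** * Formal sums modulo a congruence *)

(* Formal sums of elements of a commutative monoid, modulo a congruence.      *)
(* Quotient rings, tensor products and monoid algebras are all of this form.  *)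
Record presentation := Presentation {
  gens : choiceType;
  gen1 : gens;
  genM : gens -> gens -> gens;
  genN : gens -> gens;
  genMA : associative genM;
  genMC : commutative genM;
  gen1M : left_id gen1 genM;
  sum_eq : seq gens -> seq gens -> Prop;
  sum_eq_perm : forall s t, perm_eq s t -> sum_eq s t;
  sum_eq_sym : forall s t, sum_eq s t -> sum_eq t s;
  sum_eq_trans : forall s t u, sum_eq s t -> sum_eq t u -> sum_eq s u;
  sum_eq_cat : forall u s t, sum_eq s t -> sum_eq (u ++ s) (u ++ t);
  sum_eq_mul : forall p s t,
    sum_eq s t -> sum_eq [seq genM p q | q <- s] [seq genM p q | q <- t];
  sum_eq_opp : forall p, sum_eq [:: genN p; p] [::]
}.

Section FormalSums.
Variable X : presentation.
Implicit Types (p q : gens X) (s t u v : seq (gens X)).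

Definition fsum_rel : rel (seq (gens X)) := fun s t => `[< sum_eq s t >].

Lemma fsum_rel_refl : reflexive fsum_rel.
Proof. by move=> s; apply/asboolP/sum_eq_perm. Qed.

Lemma fsum_rel_sym : symmetric fsum_rel.
Proof. by move=> s t; apply/asboolP/asboolP => /sum_eq_sym. Qed.

Lemma fsum_rel_trans : transitive fsum_rel.
Proof.
by move=> t s u /asboolP st /asboolP tu; apply/asboolP; apply: sum_eq_trans tu.
Qed.

Canonical fsum_equiv : equiv_rel (seq (gens X)) :=
  EquivRel fsum_rel fsum_rel_refl fsum_rel_sym fsum_rel_trans.

Definition fsum : Type := {eq_quot fsum_equiv}.
HB.instance Definition _ := Choice.on fsum.

Definition fsum_of s : fsum := \pi_({eq_quot fsum_equiv}) s.

Lemma fsum_ofP s t : fsum_of s = fsum_of t <-> sum_eq s t.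
Proof. by split=> [/eqmodP/asboolP//|H]; apply/eqmodP/asboolP. Qed.

Lemma fsum_of_perm s t : perm_eq s t -> fsum_of s = fsum_of t.
Proof. by move=> st; apply/fsum_ofP/sum_eq_perm. Qed.

Lemma fsum_of_repr (x : fsum) : fsum_of (repr x) = x.
Proof. exact: reprK. Qed.

Lemma fsumW (P : fsum -> Prop) : (forall s, P (fsum_of s)) -> forall x, P x.
Proof. by move=> Ps x; rewrite -(fsum_of_repr x). Qed.

Definition sum_mul s t := [seq genM p q | p <- s, q <- t].

Lemma sum_eq_cat2 s s' t t' :
  sum_eq s s' -> sum_eq t t' -> sum_eq (s ++ t) (s' ++ t').
Proof.
have catC u v : sum_eq (u ++ v) (v ++ u).
  by apply: sum_eq_perm; rewrite perm_catC.
move=> ss tt; apply: sum_eq_trans (sum_eq_cat _ tt) _.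
by apply: sum_eq_trans (catC _ _) (sum_eq_trans (sum_eq_cat _ ss) (catC _ _)).
Qed.

Lemma sum_mul_cons p s t :
  sum_mul (p :: s) t = [seq genM p q | q <- t] ++ sum_mul s t.
Proof. by []. Qed.

Lemma sum_mul_catl s t u : sum_mul (s ++ t) u = sum_mul s u ++ sum_mul t u.
Proof. by elim: s => // p s IHs; rewrite /= !sum_mul_cons IHs catA. Qed.

Lemma sum_mulC s t : perm_eq (sum_mul s t) (sum_mul t s).
Proof.
elim: t => [|q t IHt]; first by rewrite /sum_mul; elim: s.
rewrite perm_allpairs_consr /= perm_cat //.
by under eq_map do rewrite genMC.
Qed.

Lemma sum_eq_mulr s t t' : sum_eq t t' -> sum_eq (sum_mul s t) (sum_mul s t').
Proof.
move=> tt; elim: s => [|p s IHs] /=; first exact: sum_eq_perm.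
exact: sum_eq_cat2 (sum_eq_mul p tt) IHs.
Qed.

Lemma sum_eq_mull s s' t : sum_eq s s' -> sum_eq (sum_mul s t) (sum_mul s' t).
Proof.
move=> ss; apply: sum_eq_trans (sum_eq_perm (sum_mulC _ _)) _.
by apply: sum_eq_trans (sum_eq_mulr t ss) (sum_eq_perm (sum_mulC _ _)).
Qed.

Definition fsum_zero : fsum := fsum_of [::].
Definition fsum_one : fsum := fsum_of [:: gen1 X].
Definition fsum_opp (x : fsum) : fsum :=
  fsum_of [seq genN p | p <- repr x].
Definition fsum_add (x y : fsum) : fsum := fsum_of (repr x ++ repr y).
Definition fsum_mul (x y : fsum) : fsum := fsum_of (sum_mul (repr x) (repr y)).

Lemma fsum_ofD s t : fsum_add (fsum_of s) (fsum_of t) = fsum_of (s ++ t).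
Proof.
by apply/fsum_ofP/sum_eq_cat2; apply/fsum_ofP; rewrite fsum_of_repr.
Qed.

Lemma fsum_ofM s t : fsum_mul (fsum_of s) (fsum_of t) = fsum_of (sum_mul s t).
Proof.
apply/fsum_ofP; apply: (@sum_eq_trans _ _ (sum_mul s (repr (fsum_of t)))).
  by apply/sum_eq_mull/fsum_ofP; rewrite fsum_of_repr.
by apply/sum_eq_mulr/fsum_ofP; rewrite fsum_of_repr.
Qed.

Lemma fsum_addA : associative fsum_add.
Proof.
elim/fsumW=> s; elim/fsumW=> t; elim/fsumW=> u.
by rewrite !fsum_ofD catA.
Qed.

Lemma fsum_addC : commutative fsum_add.
Proof.
elim/fsumW=> s; elim/fsumW=> t; rewrite !fsum_ofD; apply: fsum_of_perm.
by rewrite perm_catC.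
Qed.

Lemma fsum_add0 : left_id fsum_zero fsum_add.
Proof. by elim/fsumW=> s; rewrite fsum_ofD. Qed.

Lemma fsum_addN : left_inverse fsum_zero fsum_opp fsum_add.
Proof.
move=> x; rewrite -{2}(fsum_of_repr x) /fsum_opp fsum_ofD.
elim: (repr x) => [|p s IHs] //=.
rewrite (@fsum_of_perm _ ([:: genN p; p] ++ ([seq genN p | p <- s] ++ s))).
  rewrite -fsum_ofD IHs fsum_ofD cats0; exact/fsum_ofP/sum_eq_opp.
by rewrite /= perm_cons -[p :: s]cat1s perm_catCA perm_refl.
Qed.

HB.instance Definition _ :=
  GRing.isZmodule.Build fsum fsum_addA fsum_addC fsum_add0 fsum_addN.

Lemma fsum_mulA : associative fsum_mul.
Proof.
elim/fsumW=> s; elim/fsumW=> t; elim/fsumW=> u.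
rewrite !fsum_ofM; congr fsum_of.
elim: s => // p s IHs; rewrite !sum_mul_cons sum_mul_catl IHs; congr (_ ++ _).
elim: t {IHs} => // q t IHt; rewrite sum_mul_cons map_cat IHt /= sum_mul_cons.
by rewrite -map_comp; congr (_ ++ _); apply: eq_map => r /=; rewrite genMA.
Qed.

Lemma fsum_mulC : commutative fsum_mul.
Proof.
elim/fsumW=> s; elim/fsumW=> t; rewrite !fsum_ofM.
exact/fsum_of_perm/sum_mulC.
Qed.

Lemma fsum_mul1 : left_id fsum_one fsum_mul.
Proof.
elim/fsumW=> s; rewrite fsum_ofM; congr fsum_of.
by rewrite /sum_mul /= cats0 -[RHS]map_id; apply: eq_map => p; rewrite gen1M.
Qed.

Lemma fsum_mulDl : left_distributive fsum_mul fsum_add.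
Proof.
elim/fsumW=> s; elim/fsumW=> t; elim/fsumW=> u.
by rewrite !(fsum_ofD, fsum_ofM) sum_mul_catl.
Qed.

HB.instance Definition _ := GRing.Zmodule_isComPzRing.Build fsum
  fsum_mulA fsum_mulC fsum_mul1 fsum_mulDl.

Definition fgen p : fsum := fsum_of [:: p].

Lemma fsum_of_sum s : fsum_of s = \sum_(p <- s) fgen p.
Proof.
elim: s => [|p s IHs]; first by rewrite big_nil.
by rewrite big_cons -IHs -[RHS]/(fsum_add _ _) fsum_ofD.
Qed.

Lemma fgenM p q : fgen (genM p q) = fgen p * fgen q.
Proof. by rewrite -[RHS]/(fsum_mul _ _) fsum_ofM. Qed.

Lemma fgen1 : fgen (gen1 X) = 1. Proof. by []. Qed.

End FormalSums.

Section FsumEval.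
Variables (X : presentation) (A : comPzRingType) (h : gens X -> A).
Hypotheses (h1 : h (gen1 X) = 1)
  (hM : forall p q, h (genM p q) = h p * h q)
  (hE : forall s t : seq (gens X), sum_eq s t ->
    \sum_(p <- s) h p = \sum_(p <- t) h p).

Definition fsum_eval_fun (x : fsum X) : A := \sum_(p <- repr x) h p.

Lemma fsum_eval_funE s : fsum_eval_fun (fsum_of s) = \sum_(p <- s) h p.
Proof. by apply: hE; apply/fsum_ofP; rewrite fsum_of_repr. Qed.

Lemma fsum_eval_funD : {morph fsum_eval_fun : x y / x + y}.
Proof.
elim/fsumW=> s; elim/fsumW=> t.
by rewrite -[_ + fsum_of _]/(fsum_add _ _) fsum_ofD !fsum_eval_funE big_cat.
Qed.

Lemma fsum_eval_is_zmod_morphism : zmod_morphism fsum_eval_fun.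
Proof.
by move=> x y; apply/eqP; rewrite eq_sym subr_eq -fsum_eval_funD subrK.
Qed.

Lemma fsum_eval_is_monoid_morphism : monoid_morphism fsum_eval_fun.
Proof.
split; first by rewrite -fgen1 fsum_eval_funE big_seq1.
elim/fsumW=> s; elim/fsumW=> t.
rewrite -[_ * fsum_of _]/(fsum_mul _ _) fsum_ofM !fsum_eval_funE /sum_mul.
rewrite big_allpairs_dep mulr_suml; apply: eq_bigr => p _.
by rewrite mulr_sumr; apply: eq_bigr => q _; rewrite hM.
Qed.

HB.instance Definition _ := GRing.isZmodMorphism.Build (fsum X) A fsum_eval_fun
  fsum_eval_is_zmod_morphism.
HB.instance Definition _ := GRing.isMonoidMorphism.Build (fsum X) A
  fsum_eval_fun fsum_eval_is_monoid_morphism.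

Definition fsum_eval : {rmorphism fsum X -> A} := fsum_eval_fun.

Lemma fsum_eval_of s : fsum_eval (fsum_of s) = \sum_(p <- s) h p.
Proof. exact: fsum_eval_funE. Qed.

Lemma fsum_eval_gen p : fsum_eval (fgen p) = h p.
Proof. by rewrite fsum_eval_of big_seq1. Qed.

End FsumEval.

Section QuotientRing.
Variables (A : comPzRingType) (I : A -> Prop).
Hypotheses (I0 : I 0) (ID : forall x y, I x -> I y -> I (x + y))
  (IM : forall a x, I x -> I (a * x)).

(** Every element of A is a generator, and a formal sum counts only through its value in A modulo I,
    so the ring of formal sums is A/I. *)
Definition quot_eq (s t : seq A) := I (\sum_(p <- s) p - \sum_(p <- t) p).

Lemma quot_eq_perm s t : perm_eq s t -> quot_eq s t.
Proof. by move=> st; rewrite /quot_eq (perm_big _ st) subrr. Qed.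

Lemma quot_eq_sym s t : quot_eq s t -> quot_eq t s.
Proof. by move=> /(IM (-1)); rewrite mulN1r opprB. Qed.

Lemma quot_eq_trans s t u : quot_eq s t -> quot_eq t u -> quot_eq s u.
Proof. by move=> /ID H /H; rewrite /quot_eq addrA subrK. Qed.

Lemma quot_eq_cat u s t : quot_eq s t -> quot_eq (u ++ s) (u ++ t).
Proof. by rewrite /quot_eq !big_cat opprD addrACA subrr add0r. Qed.

Lemma quot_eq_mul p s t :
  quot_eq s t -> quot_eq [seq p * q | q <- s] [seq p * q | q <- t].
Proof. by move=> /(IM p); rewrite /quot_eq !big_map -!mulr_sumr mulrBr. Qed.

Lemma quot_eq_opp p : quot_eq [:: - p; p] [::].
Proof. by rewrite /quot_eq big_cons big_seq1 big_nil subr0 addNr. Qed.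

Definition quot_pres : presentation := @Presentation A 1 *%R -%R
  (@mulrA A) (@mulrC A) (@mul1r A) quot_eq quot_eq_perm quot_eq_sym
  quot_eq_trans quot_eq_cat quot_eq_mul quot_eq_opp.

Definition quot_ring : comPzRingType := fsum quot_pres.

Definition quot_pi_fun (x : A) : quot_ring := @fgen quot_pres x.

Lemma quot_pi_is_zmod_morphism : zmod_morphism quot_pi_fun.
Proof.
move=> x y; apply/eqP; rewrite eq_sym subr_eq; apply/eqP.
rewrite -[RHS]/(@fsum_add quot_pres _ _) fsum_ofD; apply/fsum_ofP.
by rewrite /= /quot_eq big_seq1 big_cons big_seq1 subrK subrr.
Qed.

Lemma quot_pi_is_monoid_morphism : monoid_morphism quot_pi_fun.
Proof. by split=> // x y; apply: fgenM. Qed.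

HB.instance Definition _ := GRing.isZmodMorphism.Build A quot_ring quot_pi_fun
  quot_pi_is_zmod_morphism.
HB.instance Definition _ := GRing.isMonoidMorphism.Build A quot_ring
  quot_pi_fun quot_pi_is_monoid_morphism.

Definition quot_pi : {rmorphism A -> quot_ring} := quot_pi_fun.

Lemma quot_piP x y : quot_pi x = quot_pi y <-> I (x - y).
Proof. by rewrite fsum_ofP /= /quot_eq !big_seq1. Qed.

Lemma quot_pi_surj (x : quot_ring) : exists a, quot_pi a = x.
Proof.
elim/fsumW: x => s; exists (\sum_(p <- s) p); apply/fsum_ofP.
by rewrite /= /quot_eq big_seq1 subrr.
Qed.

End QuotientRing.

(** * Connected quotients and monoid algebras *)

(** With c = 1 + y + ... + y^(k-1), the element x c = 1 - y^k fixes w; so does its k-th power, which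
    is a multiple of x^k and kills w. *)
Lemma comaximalX_eq0 (A : comPzRingType) (x y w : A) k :
  x + y = 1 -> w * x ^+ k = 0 -> w * y ^+ k = 0 -> w = 0.
Proof.
move=> xy wx wy; pose c := \sum_(i < k) y ^+ i.
have wE : w = w * (x * c).
  have -> : x * c = 1 - y ^+ k.
    have -> : x = - (y - 1) by rewrite -xy; ring.
    by rewrite mulNr -subrX1 opprB.
  by rewrite mulrBr mulr1 wy subr0.
have wX j : w = w * (x * c) ^+ j.
  by elim: j => [|j IHj]; rewrite ?mulr1 // exprS mulrA -wE.
by rewrite (wX k) exprMn mulrA wx mul0r.
Qed.

(* If [I] is maximal among the ideals avoiding [w], then [w] lies in every    *)
(* nonzero ideal of A/I, whereas two comaximal ideals with product zero meet  *)
(* in zero.                                                                   *)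
Lemma exists_connected_quotient (A : comPzRingType) (w : A) : w <> 0 ->
  exists (B : comPzRingType) (pi : {rmorphism A -> B}),
    connected_ring B /\ pi w <> 0.
Proof.
move=> w0.
pose P (I : set A) := [/\ ~ I w, forall x y, I x -> I y -> I (x + y) &
  forall a x, I x -> I (a * x)].
have [I [[Iw ID IM] Imax]] :
    exists I, P I /\ forall J, (I `<` J)%classic -> ~ P J.
  apply: Zorn_bigcup => F FP Ftot.
  split=> [[J FJ /=]|x y [J FJ Jx] [K FK Ky]|a x [J FJ Jx]].
  - by have [] := FP _ FJ.
  - have [JK|KJ] := Ftot _ _ FJ FK.
      by exists K => //; have [_ KD _] := FP _ FK; apply: KD => //; apply: JK.
    by exists J => //; have [_ JD _] := FP _ FJ; apply: JD => //; apply: KJ.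
  - by exists J => //; have [_ _] := FP _ FJ; apply.
(* [P] does not demand 0, so that the union of the empty chain satisfies it. A maximal I is nonempty
   all the same, since the zero ideal satisfies [P] and would strictly contain the empty set. *)
have I0 : I 0.
  apply: contrapT => nI0.
  have In x : ~ I x by move=> /(IM 0); rewrite mul0r.
  apply: (Imax [set 0]%classic).
    by split=> [x /In //|/(_ 0 erefl)].
  split=> [/= /w0 //|x y /= -> ->|a x /= ->]; first by rewrite addr0.
  by rewrite mulr0.
pose pi := quot_pi I0 ID IM.
have piE0 x : pi x = 0 <-> I x.
  by rewrite -(rmorph0 pi) /pi quot_piP subr0.
exists (quot_ring I0 ID IM), pi; split; last by move/piE0.
(* The ideal I + A a is strictly larger than I, so by maximality it contains w. *)
have wmem a : ~ I a -> exists v, pi w = v * pi a.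
  move=> nIa; pose J : set A := fun x => exists u v, I u /\ x = u + v * a.
  have : ~ P J.
    apply: Imax; split=> [x Ix|JI]; first by exists x, 0; rewrite mul0r addr0.
    by apply: nIa; apply: JI; exists 0, 1; rewrite add0r mul1r.
  apply: contra_notP => nw; split.
  - move=> [u [v [Iu e]]]; apply: nw; exists (pi v).
    by rewrite e rmorphD rmorphM (iffRL (piE0 u)) // add0r.
  - move=> x y [u [v [Iu ->]]] [u' [v' [Iu' ->]]].
    by exists (u + u'), (v + v'); split; [exact: (ID _ _ Iu) | ring].
  - move=> b x [u [v [Iu ->]]].
    by exists (b * u), (b * v); split; [exact: (IM b) | ring].
move=> x y xy [k xyk]; apply: contrapT => nxy.
have [a ax] := quot_pi_surj x; have [b bY] := quot_pi_surj y.
(* Neither x nor y is nilpotent, so the image of w is a multiple of both x^k and y^k; as x^k y^k =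
   0, it is killed by both. *)
have [v wv] : exists v, pi w = v * x ^+ k.
  rewrite -ax -/pi -rmorphXn; apply: wmem => /piE0.
  rewrite rmorphXn /pi ax => xk.
  by apply: nxy; left; exists k.
have [v' wv'] : exists v, pi w = v * y ^+ k.
  rewrite -bY -/pi -rmorphXn; apply: wmem => /piE0.
  rewrite rmorphXn /pi bY => yk.
  by apply: nxy; right; exists k.
apply: Iw; apply/piE0; apply: (comaximalX_eq0 (k := k) xy).
  by rewrite wv' -mulrA -exprMn [y * x]mulrC xyk mulr0.
by rewrite wv -mulrA -exprMn xyk mulr0.
Qed.

(* A commutative monoid with an ideal of elements which are set to zero in    *)
(* the monoid algebra.                                                        *)
Record null_monoid := NullMonoid {
  nm_elt :> choiceType;
  nm1 : nm_elt;
  nmM : nm_elt -> nm_elt -> nm_elt;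
  nmMA : associative nmM;
  nmMC : commutative nmM;
  nm1M : left_id nm1 nmM;
  nm_null : pred nm_elt;
  nm_nullM : forall m n, nm_null n -> nm_null (nmM m n)
}.

Section MonoidAlgebra.
Variables (D : comPzRingType) (M : null_monoid).
Implicit Types (s t u : seq (D * M)) (m : M).

Definition mcoef s m : D := \sum_(p <- s | p.2 == m) p.1.

(** Comparing coefficients makes the resulting algebra the free D-module on the elements that are
    not null. *)
Definition malg_eq s t : Prop :=
  forall m, ~~ nm_null m -> mcoef s m = mcoef t m.

(** Collecting the terms with the same monoid element expresses each sum through the coefficients;
    the null elements, where these may differ, are killed by h. *)
Lemma malg_eq_sum (A : comPzRingType) (f : {rmorphism D -> A}) (h : M -> A)
    s t :
  (forall m, nm_null m -> h m = 0) -> malg_eq s t ->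
  \sum_(p <- s) f p.1 * h p.2 = \sum_(p <- t) f p.1 * h p.2.
Proof.
move=> h0 st; pose r := undup [seq p.2 | p <- s ++ t].
have sumE v : {subset v <= s ++ t} ->
    \sum_(p <- v) f p.1 * h p.2 = \sum_(m <- r) f (mcoef v m) * h m.
  move=> vst; transitivity
      (\sum_(p <- v) \sum_(m <- r | m == p.2) f p.1 * h m).
    rewrite big_seq [RHS]big_seq; apply: eq_bigr => p pv.
    rewrite -big_filter filter_pred1_uniq ?undup_uniq ?big_seq1 //.
    by rewrite mem_undup; apply: map_f; apply: vst.
  rewrite (exchange_big_dep xpredT) //=; apply: eq_bigr => m _.
  by rewrite -mulr_suml -rmorph_sum; under eq_bigl do rewrite eq_sym.
rewrite !sumE; first last.
- by move=> p ps; rewrite mem_cat ps.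
- by move=> p ps; rewrite mem_cat ps orbT.
apply: eq_bigr => m _; have [/h0 ->|/st ->//] := boolP (nm_null m).
by rewrite !mulr0.
Qed.

Definition malgM (p q : D * M) : D * M := (p.1 * q.1, nmM p.2 q.2).

Lemma malgMA : associative malgM.
Proof. by move=> p q r; rewrite /malgM /= mulrA nmMA. Qed.

Lemma malgMC : commutative malgM.
Proof. by move=> p q; rewrite /malgM mulrC nmMC. Qed.

Lemma malg1M : left_id (1, nm1 M) malgM.
Proof. by move=> [d m]; rewrite /malgM /= mul1r nm1M. Qed.

Lemma malg_eq_perm s t : perm_eq s t -> malg_eq s t.
Proof. by move=> st m _; apply: perm_big. Qed.

Lemma malg_eq_sym s t : malg_eq s t -> malg_eq t s.
Proof. by move=> st m /st. Qed.

Lemma malg_eq_trans s t u : malg_eq s t -> malg_eq t u -> malg_eq s u.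
Proof. by move=> st tu m m0; rewrite st ?tu. Qed.

Lemma malg_eq_cat u s t : malg_eq s t -> malg_eq (u ++ s) (u ++ t).
Proof.
by move=> st m m0; rewrite /mcoef !big_cat; congr (_ + _); apply: st.
Qed.

Lemma malg_eq_mul p s t :
  malg_eq s t -> malg_eq [seq malgM p q | q <- s] [seq malgM p q | q <- t].
Proof.
move=> st m m0; rewrite /mcoef !big_map /=.
(* The coefficient at m of a product with p is a sum weighted by this h. It vanishes on null
   elements, because their multiples are null and m is not. *)
pose h m' := if nmM p.2 m' == m then p.1 else 0.
have hE v : \sum_(q <- v | nmM p.2 q.2 == m) p.1 * q.1 =
    \sum_(q <- v) (idfun : {rmorphism D -> D}) q.1 * h q.2.
  rewrite big_mkcond; apply: eq_bigr => q _; rewrite /h.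
  by case: ifP; rewrite ?mulr0 // mulrC.
rewrite !hE; apply: malg_eq_sum => // m' m'0; rewrite /h.
by case: eqP => // e; rewrite -e nm_nullM in m0.
Qed.

Lemma malg_eq_opp (p : D * M) : malg_eq [:: (- p.1, p.2); p] [::].
Proof.
move=> m _; rewrite /mcoef !big_cons big_nil /=.
by case: ifP => [->|->] //; rewrite addr0 addNr.
Qed.

Definition malg_pres : presentation := Presentation
  malgMA malgMC malg1M malg_eq_perm malg_eq_sym malg_eq_trans malg_eq_cat
  malg_eq_mul malg_eq_opp.

Definition malg : comPzRingType := fsum malg_pres.

Definition mmono (m : M) : malg := @fgen malg_pres (1, m).

Lemma mmonoM m m' : mmono (nmM m m') = mmono m * mmono m'.
Proof. by rewrite -fgenM /= /malgM /= mulr1. Qed.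

Lemma mmono1 : mmono (nm1 M) = 1. Proof. by []. Qed.

Lemma mmono_null m : nm_null m -> mmono m = 0.
Proof.
move=> m0; apply/fsum_ofP => m' m'0; rewrite /mcoef big_cons !big_nil /=.
by case: eqP => // e; rewrite -e m0 in m'0.
Qed.

Definition mconst_fun (d : D) : malg := @fgen malg_pres (d, nm1 M).

Lemma mconst_is_zmod_morphism : zmod_morphism mconst_fun.
Proof.
move=> x y; apply/eqP; rewrite eq_sym subr_eq; apply/eqP.
rewrite -[RHS]/(@fsum_add malg_pres _ _) fsum_ofD; apply/fsum_ofP => m _.
by rewrite /mcoef !big_cons !big_nil /=; case: ifP; rewrite ?addr0 ?subrK.
Qed.

Lemma mconst_is_monoid_morphism : monoid_morphism mconst_fun.
Proof. by split=> // x y; rewrite -[RHS]fgenM /= /malgM /= nm1M. Qed.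

HB.instance Definition _ := GRing.isZmodMorphism.Build D malg mconst_fun
  mconst_is_zmod_morphism.
HB.instance Definition _ := GRing.isMonoidMorphism.Build D malg
  mconst_fun mconst_is_monoid_morphism.

Definition mconst : {rmorphism D -> malg} := mconst_fun.

Lemma malg_gen (d : D) m : @fgen malg_pres (d, m) = mconst d * mmono m.
Proof. by rewrite -[RHS]fgenM /= /malgM /= mulr1 nm1M. Qed.

End MonoidAlgebra.

Arguments mmono : clear implicits.
Arguments mconst : clear implicits.

Section MalgEval.
Variables (D : comPzRingType) (M : null_monoid) (A : comPzRingType).
Variables (f : {rmorphism D -> A}) (h : M -> A).
Hypotheses (h1 : h (nm1 M) = 1) (hM : forall m n, h (nmM m n) = h m * h n)
  (h0 : forall m, nm_null m -> h m = 0).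

Let g (p : D * M) : A := f p.1 * h p.2.

Fact malg_eval1 : g (1, nm1 M) = 1.
Proof. by rewrite /g rmorph1 h1 mulr1. Qed.

Fact malg_evalM p q : g (malgM p q) = g p * g q.
Proof. by rewrite /g rmorphM hM mulrACA. Qed.

Fact malg_eval_eq (s t : seq (D * M)) :
  malg_eq s t -> \sum_(p <- s) g p = \sum_(p <- t) g p.
Proof. exact: malg_eq_sum. Qed.

Definition malg_eval : {rmorphism malg D M -> A} :=
  @fsum_eval (malg_pres D M) A g malg_eval1 malg_evalM malg_eval_eq.

Lemma malg_eval_const d : malg_eval (mconst D M d) = f d.
Proof. by rewrite [LHS]fsum_eval_gen /g h1 mulr1. Qed.

Lemma malg_eval_mono m : malg_eval (mmono D M m) = h m.
Proof. by rewrite [LHS]fsum_eval_gen /g rmorph1 mul1r. Qed.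

End MalgEval.

(** Such an F applies f to each coefficient, and an element is determined by its coefficients at the
    elements that are not null. *)
Lemma malg_map_injective (D D' : comPzRingType) (M : null_monoid)
    (f : {rmorphism D -> D'}) (F : {rmorphism malg D M -> malg D' M}) :
  injective f -> (forall d, F (mconst D M d) = mconst D' M (f d)) ->
  (forall m, F (mmono D M m) = mmono D' M m) -> injective F.
Proof.
move=> f_inj Fc Fm.
have FE (s : seq (D * M)) : F (@fsum_of (malg_pres D M) s) =
    @fsum_of (malg_pres D' M) [seq (f p.1, p.2) | p <- s].
  rewrite !fsum_of_sum rmorph_sum big_map; apply: eq_bigr => -[d m] _.
  by rewrite !malg_gen rmorphM Fc Fm.
elim/fsumW=> s; elim/fsumW=> t; rewrite !FE => /fsum_ofP st.
apply/fsum_ofP => m /st; rewrite /mcoef !big_map /= -!rmorph_sum.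
exact: f_inj.
Qed.

(** * The tensor product of two algebras *)

Section TensorRing.
Variables (R S : comPzRingType) (phi : {rmorphism R -> S}) (D : algebra R).

Let M : lmodType R := alg_module (Algebra phi).
Let N : lmodType R := alg_module D.

Definition tensor_gen : choiceType := (S * D)%type.

Definition tgenM (p q : tensor_gen) : tensor_gen := (p.1 * q.1, p.2 * q.2).
Definition tgenN (p : tensor_gen) : tensor_gen := (- p.1, p.2).

Lemma tgenMA : associative tgenM.
Proof. by move=> p q r; rewrite /tgenM /= !mulrA. Qed.

Lemma tgenMC : commutative tgenM.
Proof. by move=> p q; rewrite /tgenM mulrC [p.2 * _]mulrC. Qed.

Lemma tgen1M : left_id (1, 1) tgenM.
Proof. by move=> [s d]; rewrite /tgenM /= !mul1r. Qed.

Lemma tensor_eq_mul (p : tensor_gen) (s t : seq tensor_gen) :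
  @tensor_eq R M N s t ->
  @tensor_eq R M N [seq tgenM p q | q <- s] [seq tgenM p q | q <- t].
Proof.
elim=> {s t} /=.
- by move=> s t st; apply/tensor_eq_perm/perm_map.
- by move=> s t _; apply: tensor_eq_sym.
- by move=> s t u _ st _ tu; apply: tensor_eq_trans st tu.
- by move=> u s t _ st; rewrite !map_cat; apply: tensor_eq_cat.
- by move=> m m' n; rewrite /tgenM /= mulrDr; apply: tensor_eq_addl.
- by move=> m n n'; rewrite /tgenM /= mulrDr; apply: tensor_eq_addr.
- move=> r m n; rewrite /tgenM /=.
  have -> : p.1 * (r *: m : M) = r *: (p.1 * m : M) :> M by apply: mulrCA.
  have -> : p.2 * (r *: n : N) = r *: (p.2 * n : N) :> N by apply: mulrCA.
  exact: tensor_eq_scale.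
- by move=> n; rewrite /tgenM /= mulr0; apply: tensor_eq_zero.
Qed.

Lemma tensor_eq_opp (p : tensor_gen) : @tensor_eq R M N [:: tgenN p; p] [::].
Proof.
case: p => s d; apply: tensor_eq_trans (@tensor_eq_zero R M N d).
rewrite -(addNr (s : M)); exact/tensor_eq_sym/tensor_eq_addl.
Qed.

(** The congruence is the one that defines [tensor], so flatness speaks directly about equality in
    this ring. *)
Definition tensor_pres : presentation := @Presentation tensor_gen (1, 1)
  tgenM tgenN tgenMA tgenMC tgen1M (@tensor_eq R M N) (@tensor_eq_perm R M N)
  (@tensor_eq_sym R M N) (@tensor_eq_trans R M N) (@tensor_eq_cat R M N)
  tensor_eq_mul tensor_eq_opp.

Definition tensor_ring : comPzRingType := fsum tensor_pres.

Definition tensor_inl_fun (s : S) : tensor_ring := @fgen tensor_pres (s, 1).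
Definition tensor_inr_fun (d : D) : tensor_ring := @fgen tensor_pres (1, d).

Lemma tensor_inl_is_zmod_morphism : zmod_morphism tensor_inl_fun.
Proof.
move=> x y; apply/eqP; rewrite eq_sym subr_eq; apply/eqP.
rewrite -[RHS]/(@fsum_add tensor_pres _ _) fsum_ofD; apply/fsum_ofP.
by rewrite -{1}(subrK y x); apply: tensor_eq_addl.
Qed.

Lemma tensor_inr_is_zmod_morphism : zmod_morphism tensor_inr_fun.
Proof.
move=> x y; apply/eqP; rewrite eq_sym subr_eq; apply/eqP.
rewrite -[RHS]/(@fsum_add tensor_pres _ _) fsum_ofD; apply/fsum_ofP.
by rewrite -{1}(subrK y x); apply: tensor_eq_addr.
Qed.

Lemma tensor_inl_is_monoid_morphism : monoid_morphism tensor_inl_fun.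
Proof. by split=> // x y; rewrite -[RHS]fgenM /= /tgenM /= mulr1. Qed.

Lemma tensor_inr_is_monoid_morphism : monoid_morphism tensor_inr_fun.
Proof. by split=> // x y; rewrite -[RHS]fgenM /= /tgenM /= mulr1. Qed.

HB.instance Definition _ := GRing.isZmodMorphism.Build S tensor_ring
  tensor_inl_fun tensor_inl_is_zmod_morphism.
HB.instance Definition _ := GRing.isMonoidMorphism.Build S tensor_ring
  tensor_inl_fun tensor_inl_is_monoid_morphism.
HB.instance Definition _ := GRing.isZmodMorphism.Build D tensor_ring
  tensor_inr_fun tensor_inr_is_zmod_morphism.
HB.instance Definition _ := GRing.isMonoidMorphism.Build D tensor_ring
  tensor_inr_fun tensor_inr_is_monoid_morphism.

Definition tensor_algebra : algebra S :=
  @Algebra S tensor_ring (tensor_inl_fun : {rmorphism S -> tensor_ring}).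

Lemma tensor_inr_alg r :
  tensor_inr_fun (alg_map D r) = alg_map tensor_algebra (phi r).
Proof.
apply/fsum_ofP => /=.
have := @tensor_eq_scale R M N r 1 1.
rewrite /GRing.scale /= /alg_scale /= !mulr1; exact: tensor_eq_sym.
Qed.

Definition tensor_inr : alg_hom D (restrict_scalars phi tensor_algebra) :=
  @AlgHom R D (restrict_scalars phi tensor_algebra)
    (tensor_inr_fun : {rmorphism D -> tensor_ring}) tensor_inr_alg.

Let R1 : lmodType R := alg_module (Algebra (idfun : {rmorphism R -> R})).

Let phi_mod (r : R1) : M := phi r.

Fact phi_mod_is_zmod_morphism : zmod_morphism phi_mod.
Proof. exact: rmorphB. Qed.

Fact phi_mod_is_scalable : scalable phi_mod.
Proof. exact: rmorphM. Qed.

HB.instance Definition _ := GRing.isZmodMorphism.Build R1 M phi_mod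
  phi_mod_is_zmod_morphism.
HB.instance Definition _ := GRing.isScalable.Build R R1 M *:%R phi_mod
  phi_mod_is_scalable.

(** The map R (x) D -> D, r (x) d -> r d, is well defined; it recovers d from 1 (x) d. *)
Fact tensor_eq_unitor (s t : seq (R1 * N)) : tensor_eq s t ->
  \sum_(p <- s) (p.1 : R) *: p.2 = \sum_(p <- t) (p.1 : R) *: p.2.
Proof.
elim=> {s t} /=.
- by move=> s t st; apply: perm_big.
- by move=> s t _ ->.
- by move=> s t u _ -> _ ->.
- by move=> u s t _ st; rewrite !big_cat /= st.
- by move=> m m' n; rewrite !big_cons !big_nil /= !addr0 scalerDl.
- by move=> m n n'; rewrite !big_cons !big_nil /= !addr0 scalerDr.
- by move=> r m n; rewrite !big_seq1 /= scalerA mulrC.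
- by move=> n; rewrite big_seq1 big_nil scale0r.
Qed.

(* D = R (x) D -> S (x) D is the base change of R -> S to D. *)
Lemma tensor_inr_injective :
  injective phi -> flat_algebra D -> injective tensor_inr.
Proof.
move=> phi_inj D_flat d d' /fsum_ofP dd'.
pose F : {linear R1 -> M} := phi_mod.
have F_inj : injective F by exact: phi_inj.
have : tensor_sum [:: ((1 : R1), (d : N))] =
    tensor_sum [:: ((1 : R1), (d' : N))].
  apply: (D_flat _ _ F F_inj); rewrite !tensor_map_sum; apply/tensor_sumP.
  by rewrite /= /phi_mod rmorph1.
by move=> /tensor_sumP /tensor_eq_unitor; rewrite !big_seq1 /= !scale1r.
Qed.

End TensorRing.

(** * Deformation of a unit *)

Lemma connected_iter_laurent n (A : comPzRingType) :
  connected_ring A -> connected_ring (iter_laurent n A).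
Proof. by move=> A_conn; elim: n => //= n IHn; apply: connected_laurent. Qed.

Lemma iter_lmap_ext n (A B : comPzRingType) (u v : {rmorphism A -> B}) :
  u =1 v -> iter_lmap n u =1 iter_lmap n v.
Proof. by move=> /rmorph_ext ->. Qed.

Fixpoint iter_const n (A : comPzRingType) : {rmorphism A -> iter_laurent n A} :=
  if n is n'.+1 then @lconst _ \o iter_const n' A else idfun.

Lemma iter_lmap_const n (A B : comPzRingType) (u : {rmorphism A -> B}) a :
  iter_lmap n u (iter_const n A a) = iter_const n B (u a).
Proof.
elim: n => //= n IHn; apply: laurent_ext => j /=.
by case: ifP => // _; rewrite rmorph0.
Qed.

(* In the lexicographic order in which the last variable dominates, [f] has a *)
(* lowest nonzero coefficient, and it is a unit.                              *)
Fixpoint has_unit_lead n (A : comPzRingType) : iter_laurent n A -> Prop :=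
  if n is n'.+1 return iter_laurent n A -> Prop then
    fun f : laurent (iter_laurent n' A) =>
      exists m, lvanish f m /\ has_unit_lead (f m)
  else @is_unit A.

Lemma unit_lead_unit n (A : comPzRingType) (f : iter_laurent n A) :
  has_unit_lead f -> is_unit f.
Proof.
by elim: n f => //= n IHn f [m [fm /IHn]]; apply: unit_lead fm.
Qed.

(** Induction on n. In the last variable, h collects the nilpotent coefficients below the order m of
    the first unit coefficient, together with the nilpotent part of that coefficient; all terms
    above m stay in g. *)
Lemma unit_lead_nilpotent_decomp n (A : comPzRingType) (f : iter_laurent n A) :
  connected_ring A -> is_unit f ->
  exists g h, [/\ f = g + h, has_unit_lead g & nilpotent h].
Proof.
move=> A_conn; elim: n f => [|n IHn] f uf.
  by exists f, 0; split; rewrite ?addr0 //; apply: nilpotent0.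
have B_conn := @connected_iter_laurent n A A_conn.
have [m [fm_nil fm_unit]] := laurent_unit_lead B_conn uf.
have [g [h [fE g_lead h_nil]]] := IHn _ fm_unit.
have [k [k_lt k_ge /(_ fm_nil) k_nil]] := lsplit f m.
exists (f - (k + lmono m h)), (k + lmono m h); split; first by rewrite subrK.
  exists m; split=> [i im|].
    rewrite lcoefD lcoefN lcoefD k_lt //= lt_eqF // addr0.
    exact: subrr.
  rewrite lcoefD lcoefN lcoefD k_ge //= eqxx add0r.
  by rewrite fE addrK.
by apply: nilpotentD => //; apply: nilpotent_lmono.
Qed.

Section CoefficientMap.
Variables (A B : comPzRingType) (s : {s : A -> B | s 0 = 0}).

Lemma lcoef_map_subproof (f : laurent A) :
  exists d : int, forall i, i < d -> sval s (f i) = 0.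
Proof.
by have [d fd] := Defs.lbound f; exists d => i /fd ->; apply: svalP s.
Qed.

Definition lcoef_map_fun (f : laurent A) : laurent B :=
  Laurent (lcoef_map_subproof f).

Lemma lcoef_map0 : lcoef_map_fun 0 = 0.
Proof. by apply: laurent_ext => i; apply: svalP s. Qed.

Definition lcoef_map : {s : laurent A -> laurent B | s 0 = 0} :=
  exist _ lcoef_map_fun lcoef_map0.

End CoefficientMap.

(** The map s is only required to fix 0, which preserves the lower bounds of series: the lift of
    coefficients to symbols is not additive. *)
Fixpoint iter_coef_map n (A B : comPzRingType) (s : {s : A -> B | s 0 = 0}) :
    {s : iter_laurent n A -> iter_laurent n B | s 0 = 0} :=
  if n is n'.+1 then lcoef_map (iter_coef_map n' s) else s.

Lemma iter_coef_map_lead n (A B : comPzRingType) (s : {s : A -> B | s 0 = 0})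
    (f : iter_laurent n A) : (forall a, is_unit a -> is_unit (sval s a)) ->
  has_unit_lead f -> has_unit_lead (sval (iter_coef_map n s) f).
Proof.
move=> su; elim: n f => [|n IHn] f /=; first exact: su.
move=> [m [fm lead_fm]]; exists m; split; last exact: IHn.
by move=> i /fm /= ->; apply: svalP (iter_coef_map n s).
Qed.

Lemma iter_lmap_coef_map n (A B E : comPzRingType) (s : {s : A -> B | s 0 = 0})
    (u : {rmorphism B -> E}) (v : {rmorphism A -> E}) f :
  (forall a, u (sval s a) = v a) ->
  iter_lmap n u (sval (iter_coef_map n s) f) = iter_lmap n v f.
Proof.
move=> us; elim: n f => [|n IHn] f //=.
by apply: laurent_ext => i; apply: IHn.
Qed.

Section DegreeMonoid.
Variables (Z : pred nat) (ZD : forall i j, Z j -> Z (i + j)%N).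
Definition degree_monoid : null_monoid :=
  @NullMonoid nat 0%N addn addnA addnC add0n Z ZD.
End DegreeMonoid.

(** Over A, the algebras of this monoid and of the next one are A[z] and A[z]/z^K. *)
Definition poly_monoid : null_monoid :=
  @degree_monoid pred0 (fun _ _ => id).

Definition trunc_monoid (K : nat) : null_monoid :=
  @degree_monoid (leq K) (fun i j Kj => leq_trans Kj (leq_addl i j)).

Section CoefficientMonoid.
Variables (A : comPzRingType) (K : nat).

(** The pair (a, k) stands for the symbol [a] z^k. Symbols multiply as elements of A do, but no
    relation is imposed on [a + b]; this keeps the algebra free over D. *)
Definition coef_monoidM (p q : A * nat) : A * nat := (p.1 * q.1, (p.2 + q.2)%N).

Lemma coef_monoidMA : associative coef_monoidM.
Proof. by move=> p q r; rewrite /coef_monoidM /= mulrA addnA. Qed.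

Lemma coef_monoidMC : commutative coef_monoidM.
Proof. by move=> p q; rewrite /coef_monoidM mulrC addnC. Qed.

Lemma coef_monoid1M : left_id (1, 0%N) coef_monoidM.
Proof. by move=> [a k]; rewrite /coef_monoidM /= mul1r. Qed.

Definition coef_monoid_null : pred (A * nat) :=
  fun p => (p.1 == 0) || (K <= p.2)%N.

Lemma coef_monoid_nullM p q :
  coef_monoid_null q -> coef_monoid_null (coef_monoidM p q).
Proof.
case/orP=> [/eqP q0|Kq]; apply/orP; first by left; rewrite /= q0 mulr0.
by right; apply: leq_trans Kq (leq_addl _ _).
Qed.

Definition coef_monoid : null_monoid :=
  @NullMonoid (A * nat)%type (1, 0%N) coef_monoidM coef_monoidMA coef_monoidMC
    coef_monoid1M coef_monoid_null coef_monoid_nullM.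

Lemma nilpotent_coef_monoid_var (D : comPzRingType) :
  nilpotent (mmono D coef_monoid (1, 1%N)).
Proof.
have varX k : mmono D coef_monoid (1, 1%N) ^+ k = mmono D coef_monoid (1, k).
  by elim: k => // k IHk; rewrite exprS IHk -mmonoM /= /coef_monoidM /= mulr1.
exists K; rewrite varX; apply: mmono_null.
by rewrite /= /coef_monoid_null leqnn orbT.
Qed.

Lemma coef_symbol0 (D : comPzRingType) : mmono D coef_monoid (0, 0%N) = 0.
Proof. by apply: mmono_null; rewrite /= /coef_monoid_null eqxx. Qed.

Definition coef_symbol (D : comPzRingType) :
    {s : A -> malg D coef_monoid | s 0 = 0} :=
  exist _ (fun a => mmono D coef_monoid (a, 0%N)) (coef_symbol0 D).

Lemma coef_symbol_unit (D : comPzRingType) (a : A) :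
  is_unit a -> is_unit (sval (coef_symbol D) a).
Proof.
move=> [b ba]; exists (sval (coef_symbol D) b).
by rewrite /= -mmonoM /= /coef_monoidM /= ba.
Qed.

End CoefficientMonoid.

Section Deformation.
Variables (n : nat) (A P : comPzRingType) (u : {rmorphism A -> P}) (z : P).

Definition deform (g h : iter_laurent n A) : iter_laurent n P :=
  iter_lmap n u g + iter_const n P z * iter_lmap n u h.

Lemma iter_lmap_lead (f : iter_laurent n A) :
  has_unit_lead f -> has_unit_lead (iter_lmap n u f).
Proof.
elim: n f => [|k IHk] f /=; first exact: is_unit_morph.
move=> [m [fm lead_fm]]; exists m; split; last exact: IHk.
by move=> i /fm /= ->; apply: rmorph0.
Qed.

Lemma deform_unit g h : has_unit_lead g -> nilpotent h -> is_unit (deform g h).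
Proof.
move=> g_lead h_nil; apply: unitD_nilpotent.
  exact/unit_lead_unit/iter_lmap_lead.
exact/nilpotentMl/nilpotent_morph.
Qed.

End Deformation.

Lemma iter_lmap_deform n (A P Q : comPzRingType) (u : {rmorphism A -> P})
    (v : {rmorphism P -> Q}) (w : {rmorphism A -> Q}) z
    (g h : iter_laurent n A) :
  (forall a, v (u a) = w a) ->
  iter_lmap n v (deform u z g h) = deform w (v z) g h.
Proof.
move=> vu; have vuE : iter_lmap n v \o iter_lmap n u =1 iter_lmap n w.
  by move=> f; rewrite -iter_lmap_comp; apply: iter_lmap_ext.
by rewrite /deform rmorphD rmorphM iter_lmap_const -!vuE.
Qed.

Lemma deform1 n (A : comPzRingType) (g h : iter_laurent n A) :
  deform (idfun : {rmorphism A -> A}) 1 g h = g + h.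
Proof. by rewrite /deform !iter_lmap_id rmorph1 mul1r. Qed.

(* Over A[z]/z^K the deformation comes from a unit with coefficients in       *)
(* D[A x N] / (a = 0 or k >= K), a free D-module.                             *)
Lemma deform_trunc_lift n (A D : comPzRingType) (K : nat)
    (r : {rmorphism malg D (coef_monoid A K) -> malg A (trunc_monoid K)})
    (g h : iter_laurent n A) :
  (forall a k, r (mmono D (coef_monoid A K) (a, k)) =
    mconst A (trunc_monoid K) a * mmono A (trunc_monoid K) k) ->
  has_unit_lead g ->
  exists2 f, is_unit f & iter_lmap n r f =
    deform (mconst A (trunc_monoid K)) (mmono A (trunc_monoid K) 1%N) g h.
Proof.
move=> rE g_lead; pose s := iter_coef_map n (coef_symbol A K D).
(* The lift of h need not be nilpotent, but its factor z is, and the lift of g keeps a unit as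
   lowest coefficient. *)
exists (sval s g +
  iter_const n _ (mmono D (coef_monoid A K) (1, 1%N)) * sval s h).
  apply: unitD_nilpotent.
    by apply/unit_lead_unit/iter_coef_map_lead => // a; apply: coef_symbol_unit.
  exact/nilpotentMr/nilpotent_morph/nilpotent_coef_monoid_var.
have rs a : r (sval (coef_symbol A K D) a) = mconst A (trunc_monoid K) a.
  by rewrite rE mmono1 mulr1.
rewrite rmorphD rmorphM iter_lmap_const !(iter_lmap_coef_map _ rs) rE.
by rewrite rmorph1 mul1r.
Qed.

(** The coefficient of z^k is still visible in A[z]/z^(k+1). *)
Lemma trunc_jointly_injective (A : comPzRingType)
    (tr : forall K, {rmorphism malg A poly_monoid -> malg A (trunc_monoid K)}) :
  (forall K a, tr K (mconst A poly_monoid a) = mconst A (trunc_monoid K) a) ->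
  (forall K k, tr K (mmono A poly_monoid k) = mmono A (trunc_monoid K) k) ->
  forall x y, (forall K, tr K x = tr K y) -> x = y.
Proof.
move=> trc trm.
have trE K (s : seq (A * nat)) : tr K (@fsum_of (malg_pres A poly_monoid) s) =
    @fsum_of (malg_pres A (trunc_monoid K)) s.
  rewrite !fsum_of_sum rmorph_sum; apply: eq_bigr => -[a k] _.
  by rewrite !malg_gen rmorphM trc trm.
elim/fsumW=> s; elim/fsumW=> t st; apply/fsum_ofP => k _.
have := st k.+1; rewrite !trE => /fsum_ofP; apply.
by rewrite /= ltnn.
Qed.

Section MalgAlgebra.
Variables (R : comPzRingType) (M : null_monoid).

Definition malg_algebra (D : algebra R) : algebra R :=
  @Algebra R (malg D M) (mconst D M \o alg_map D : {rmorphism R -> malg D M}).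

Definition mconst_alg (D : algebra R) : alg_hom D (malg_algebra D) :=
  @AlgHom R D (malg_algebra D) (mconst D M) (fun=> erefl).

Lemma malg_eval_alg (D A : algebra R) (f : alg_hom D A) (h : M -> A)
    (h1 : h (nm1 M) = 1) (hM : forall m n, h (nmM m n) = h m * h n)
    (h0 : forall m, nm_null m -> h m = 0) :
  exists F : alg_hom (malg_algebra D) A,
    (forall d, F (mconst D M d) = f d) /\ (forall m, F (mmono D M m) = h m).
Proof.
pose F := malg_eval (alg_fun f) h1 hM h0.
have FE r : F (alg_map (malg_algebra D) r) = alg_map A r.
  by rewrite -(alg_funE f r); apply: malg_eval_const.
exists (@AlgHom R (malg_algebra D) A F FE).
by split=> [d|m]; [apply: malg_eval_const | apply: malg_eval_mono].
Qed.

End MalgAlgebra.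

(** * Agreement of natural transformations *)

Section Agreement.
Variables (n N : nat) (R S : comPzRingType) (phi : {rmorphism R -> S}).
Hypothesis phi_inj : injective phi.
Variables (Y : ind_affine R) (C : algebra R).
Hypothesis Y_flat : ind_flat Y.

Let X : functor_over R := prod_functor
  (power_functor (restrict_functor R (LGm n)) N) (ind_functor Y).

Variables eta theta : nat_trans X (Spec C).
Hypothesis eta_theta : base_change_nat phi eta = base_change_nat phi theta.

Let agree (A : algebra R) (x : X A) : Prop := sval eta A x = sval theta A x.

Lemma agree_base_change (T : algebra S) (x : X (restrict_scalars phi T)) :
  agree x.
Proof.
pose ev (e : nat_trans (base_change phi X) (base_change phi (Spec C))) :=
  sval e T x.
exact: (congr1 ev eta_theta).
Qed.

Lemma agree_push (A B : algebra R) (f : alg_hom A B) (x : X A) :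
  agree x -> agree (fmap f x).
Proof.
by move=> xE; rewrite /agree (svalP eta) (svalP theta) xE.
Qed.

(** The two values at x are homomorphisms C -> A. If they differed at some c, a homomorphism
    separating the two images of c would contradict agreement after it. *)
Lemma agree_pull (A : algebra R) (x : X A) :
  (forall a b : A, a <> b -> exists (B : algebra R) (f : alg_hom A B),
    agree (fmap f x) /\ f a <> f b) -> agree x.
Proof.
move=> sep; apply: alg_hom_ext => c; apply: contrapT => /sep[B [f [+ fab]]].
rewrite /agree (svalP eta) (svalP theta).
move=> /(congr1 (fun g : alg_hom C B => g c)).
exact: fab.
Qed.

Lemma agree_injective (D T : algebra R) (f : alg_hom D T) (y : X D) :
  injective f -> agree (fmap f y) -> agree y.
Proof.
by move=> f_inj fy; apply: agree_pull => a b ab; exists T, f; split=> // /f_inj.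
Qed.

Lemma agree_connected (A : algebra R) (x : X A) : connected_ring A -> agree x.
Proof.
move=> A_conn; case: x => x y.
(* In a presentation by flat algebras, y comes from a homomorphism [y0] from a single flat algebra D
   to A. *)
have [Y' [Y'_flat [to_Y' [of_Y' [to_of of_to]]]]] := Y_flat.
have [j [y0 yE]] : exists (j : ind_index Y') (y0 : alg_hom (ind_alg j) A),
    y = sval of_Y' A (colim_in y0).
  pose y' := sval to_Y' A y; exists (tag (repr y')), (tagged (repr y')).
  by rewrite colim_in_repr to_of.
pose D := ind_alg j.
have decomp : forall i : 'I_N, exists gh : iter_laurent n A * iter_laurent n A,
    [/\ sval (x i) = gh.1 + gh.2, has_unit_lead gh.1 & nilpotent gh.2].
  move=> i; have [g [h H]] := unit_lead_nilpotent_decomp A_conn (svalP (x i)).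
  by exists (g, h).
have [gh ghP] := choice decomp.
pose Az := malg_algebra poly_monoid A.
pose AK K := malg_algebra (trunc_monoid K) A.
pose z : Az := mmono A poly_monoid 1%N.
have F_unit i : is_unit (deform (mconst A poly_monoid) z (gh i).1 (gh i).2).
  by have [_ g_lead h_nil] := ghP i; apply: deform_unit.
pose F : 'I_N -> LGm n Az := fun i => exist _ _ (F_unit i).
have [ev1 [ev1c ev1m]] : exists ev : alg_hom Az A,
    (forall a, ev (mconst A poly_monoid a) = a) /\
    (forall k, ev (mmono A poly_monoid k) = 1).
  apply: (@malg_eval_alg R poly_monoid A A (alg_id A) (fun=> 1)) => //.
  by move=> *; rewrite mulr1.
(* Setting z = 1 turns the deformed units into x, and y is unchanged along A -> A[z] -> A. *)
have -> : (x, y) = fmap ev1 ((F, fmap (mconst_alg poly_monoid A) y) : X Az).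
  congr pair.
    apply/funext => i; apply: units_ext => /=.
    rewrite (iter_lmap_deform z _ _ (w := idfun)) // ev1m deform1.
    by have [] := ghP i.
  rewrite -fmap_comp -[LHS]fmap_id; congr fmap.
  by apply: alg_hom_ext => a; rewrite /= ev1c.
apply: agree_push; apply: agree_pull => a b ab.
have trunc : forall K, exists tr : alg_hom Az (AK K),
    (forall a, tr (mconst A poly_monoid a) = mconst A (trunc_monoid K) a) /\
    (forall k, tr (mmono A poly_monoid k) = mmono A (trunc_monoid K) k).
  move=> K.
  apply: (@malg_eval_alg R poly_monoid A (AK K) (mconst_alg (trunc_monoid K) A)
    (mmono A (trunc_monoid K))) => // k l.
  exact: (@mmonoM A (trunc_monoid K)).
pose tr K := sval (cid (trunc K)); have trP K := svalP (cid (trunc K)).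
have [K trK] : exists K, tr K a <> tr K b.
  apply: contrapT => /forallNP ntr; apply: ab.
  apply: (@trunc_jointly_injective A (fun K => alg_fun (tr K))).
  - by move=> K; case: (trP K).
  - by move=> K; case: (trP K).
  - by move=> K; apply: contrapT; apply: ntr.
exists (AK K), (tr K); split=> //.
have [trc trm] := trP K.
(* The homomorphism r from B to A[z]/z^K acts on D through [y0] and sends the symbol (a, k) to a
   z^k. The deformed units lift along r, and so does y, since D maps to B. *)
pose B := malg_algebra (coef_monoid A K) D.
have [r [rc rm]] : exists r : alg_hom B (AK K),
    (forall d, r (mconst D (coef_monoid A K) d) =
      mconst A (trunc_monoid K) (y0 d)) /\
    (forall p, r (mmono D (coef_monoid A K) p) =
      mconst A (trunc_monoid K) p.1 * mmono A (trunc_monoid K) p.2).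
  apply: (@malg_eval_alg R (coef_monoid A K) D (AK K)
    (alg_comp (mconst_alg (trunc_monoid K) A) y0)
    (fun p => mconst A (trunc_monoid K) p.1 * mmono A (trunc_monoid K) p.2)).
  - by rewrite /= rmorph1 mul1r.
  - move=> p q /=; rewrite rmorphM (@mmonoM A (trunc_monoid K)); exact: mulrACA.
  - move=> p /orP[/eqP ->|Kp]; first by rewrite rmorph0 mul0r.
    by rewrite mmono_null ?mulr0.
have lift : forall i, exists f : units (iter_laurent n B),
    iter_lmap n (alg_fun r) (sval f) =
    deform (mconst A (trunc_monoid K)) (mmono A (trunc_monoid K) 1%N)
      (gh i).1 (gh i).2.
  move=> i; have [_ g_lead _] := ghP i.
  have [f f_unit fE] := deform_trunc_lift (r := alg_fun r) (gh i).2
    (fun a k => rm (a, k)) g_lead.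
  by exists (exist _ f f_unit).
have [f fP] := choice lift.
pose yB : ind_functor Y B :=
  sval of_Y' B (colim_in (mconst_alg (coef_monoid A K) D : Spec (ind_alg j) B)).
have -> : fmap (tr K) ((F, fmap (mconst_alg poly_monoid A) y) : X Az) =
    fmap r ((f, yB) : X B).
  congr pair.
    apply/funext => i; apply: units_ext => /=.
    rewrite (iter_lmap_deform z _ _ (w := mconst A (trunc_monoid K))) //.
    by rewrite trm fP.
  have of_nat (E E' : algebra R) (g : alg_hom E E') w :
      colim_map g (sval of_Y' E w) = sval of_Y' E' (colim_map g w).
    by rewrite -[LHS](svalP of_Y').
  rewrite yE /= !of_nat; congr (sval of_Y' _).
  rewrite !colim_map_in; congr colim_in; apply: alg_hom_ext => d /=.
  by rewrite trc rc.
apply: agree_push.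
(* The construction of B with S (x) D in place of D: an S-algebra that contains B. *)
pose T := malg_algebra (coef_monoid A K) (tensor_algebra phi D).
have [q [qc qm]] : exists q : alg_hom B (restrict_scalars phi T),
    (forall d, q (mconst D (coef_monoid A K) d) =
      mconst (tensor_ring phi D) (coef_monoid A K) (tensor_inr phi D d)) /\
    (forall p, q (mmono D (coef_monoid A K) p) =
      mmono (tensor_ring phi D) (coef_monoid A K) p).
  apply: (@malg_eval_alg R (coef_monoid A K) D (restrict_scalars phi T)
    (alg_comp (restrict_scalars_hom phi
        (mconst_alg (coef_monoid A K) (tensor_algebra phi D)))
      (tensor_inr phi D)) (mmono (tensor_ring phi D) (coef_monoid A K))).
  - by [].
  - exact: (@mmonoM (tensor_ring phi D) (coef_monoid A K)).
  - exact: mmono_null.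
apply: (agree_injective (f := q)); last exact: agree_base_change.
apply: (malg_map_injective (F := alg_fun q) _ qc qm).
by apply: tensor_inr_injective => //; apply: Y'_flat.
Qed.

(** If a and b differ, then a - b survives in a connected quotient of A, so the connected quotients
    separate elements. *)
Lemma agree_all (A : algebra R) (x : X A) : agree x.
Proof.
apply: agree_pull => a b ab.
have [|B [pi [B_conn piab]]] := @exists_connected_quotient A (a - b).
  by move=> /eqP; rewrite subr_eq0 => /eqP.
pose B' : algebra R := Algebra (pi \o alg_map A : {rmorphism R -> B}).
exists B', (@AlgHom R A B' pi (fun=> erefl)).
split; first exact: agree_connected.
by move=> /= e; apply: piab; rewrite rmorphB e subrr.
Qed.

End Agreement.

Theorem theorem6p12 (n : nat) (n_ge1 : (1 <= n)%N)
    (R S : comPzRingType) (phi : {rmorphism R -> S}) (phi_inj : injective phi)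
    (Y : ind_affine R) (Y_flat : ind_flat Y) (C : algebra R) (N : nat) :
  injective (base_change_nat phi :
    nat_trans
      (prod_functor (power_functor (restrict_functor R (LGm n)) N)
        (ind_functor Y))
      (Spec C) ->
    nat_trans
      (prod_functor (power_functor (restrict_functor S (LGm n)) N)
        (base_change phi (ind_functor Y)))
      (base_change phi (Spec C))).
Proof.
move=> eta theta eta_theta.
have agree := agree_all phi_inj Y_flat eta_theta.
case: eta theta agree {eta_theta} => [eta eta_nat] [theta theta_nat] /= agree.
have e : eta = theta.
  by apply: functional_extensionality_dep => A; apply/funext/agree.
case: theta / e theta_nat {agree} => theta_nat.
by congr exist; apply: Prop_irrelevance.
Qed.
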